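(* Let $G$ be a probability distribution on $[0,\infty)\times[0,1]$, let $(\lambda_i,p_i)$, $i=1,2,\dots$, be i.i.d. with distribution $G$, and conditionally on these let the pairs $(K_i,X_i)$ be independent with $K_i\sim\mathrm{Poisson}(\lambda_i)$ and $X_i\mid K_i\sim \mathrm{Binomial}(K_i,p_i)$. Put $W_{i1}=X_i$, $W_{i2}=K_i-X_i$, $\xi_{1i}=p_i\lambda_i$, $\xi_{2i}=(1-p_i)\lambda_i$, and let $G_\xi$ be the distribution of $(\xi_{1i},\xi_{2i})$. Let $\hat G_\xi$ (depending on $n$) be the GMLE based on the i.i.d. pairs $(W_{i1},W_{i2})$, $i=1,\dots,n$. Then $G_\xi$ is identifiable and $\hat G_\xi$ converges weakly to $G_\xi$ (as $n\to\infty$).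
   Context: Conditionally on $(\lambda_i,p_i)$, $W_{i1}$ and $W_{i2}$ are independent Poisson variables with parameters $\xi_{1i}$ and $\xi_{2i}$ ($\mathrm{Poisson}(0)$ is the point mass at $0$). For $w=(w_1,w_2)\in\{0,1,2,\dots\}^2$ and $\xi=(\xi_1,\xi_2)\in[0,\infty)^2$ let $f(w\mid\xi)=\prod_{k=1}^2 e^{-\xi_k}\xi_k^{w_k}/w_k!$ (with $0^0=1$), and for a probability distribution $H$ on $[0,\infty)^2$ let $f_H(w)=\int f(w\mid\xi)\,dH(\xi)$. Identifiability: $H$ is identifiable in the model $f_H$ if $f_H=f_{\tilde H}$ implies $H=\tilde H$. GMLE (generalized maximum likelihood estimator, also called NPMLE): given observations $w_1,\dots,w_n$, a GMLE is a probability distribution $\hat H$ that maximizes $\prod_{i=1}^n f_H(w_i)$ over all probability distributions $H$ on $[0,\infty)^2$. *)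

(* Defs.v *)
From HB Require Import structures.
From mathcomp Require Import all_boot all_order all_algebra finmap.
From mathcomp Require Import all_classical all_reals all_analysis.

Set Implicit Arguments.
Unset Strict Implicit.
Unset Printing Implicit Defensive.
Import Order.TTheory GRing.Theory Num.Theory.
Import numFieldNormedType.Exports.

Local Open Scope classical_set_scope.
Local Open Scope ring_scope.

Section mixture.
Context {R : realType}.
Implicit Types (H : probability (R * R)%type R) (w : nat * nat) (xi : R * R).

(* [poisson_pmf] is not used: at rate [0] it is [1] for every [k], whereas
   here Poisson(0) is the point mass at [0] ([0 ^+ 0 = 1] and [0 ^+ k.+1 = 0]). *)
Definition poisson_mass (x : R) (k : nat) : R :=
  expR (- x) * x ^+ k / k`!%:R.

Definition quadrant : set (R * R) := [set xi | 0 <= xi.1 /\ 0 <= xi.2].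

(* A distribution on [0, oo)^2 is a probability measure on the plane that gives
   mass one to the quadrant. *)
Definition on_quadrant H : Prop := H quadrant = 1%E.

Definition poisson2 w xi : R := poisson_mass xi.1 w.1 * poisson_mass xi.2 w.2.

Definition mixture H w : R := \int[H]_(xi in quadrant) poisson2 w xi.

Definition identifiable H : Prop :=
  forall H', on_quadrant H' -> mixture H =1 mixture H' ->
  forall A : set (R * R), measurable A -> H A = H' A.

Definition is_GMLE (n : nat) (w : nat -> nat * nat) H : Prop :=
  on_quadrant H /\
  forall H', on_quadrant H' ->
    \prod_(i < n) mixture H' (w i) <= \prod_(i < n) mixture H (w i).

(* Weak convergence on the space [0, oo)^2: test functions are only required
   to be continuous and bounded on the quadrant. *)
Definition weakly_converges (H_ : nat -> probability (R * R)%type R) H : Prop :=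
  forall f : R * R -> R,
    {within quadrant, continuous f} ->
    (exists M : R, forall xi, quadrant xi -> `|f xi| <= M) ->
    (\int[H_ n]_(xi in quadrant) f xi) @[n --> \oo]
      --> \int[H]_(xi in quadrant) f xi.

End mixture.

Section conditioning.
Context {d : measure_display} {Omega : measurableType d} {R : realType}.
Variable P : probability Omega R.

Definition mutually_independent {d' : measure_display} {T : measurableType d'}
    (Z : nat -> Omega -> T) : Prop :=
  forall (J : {fset nat}) (B : nat -> set T), (forall i, measurable (B i)) ->
    P (\bigcap_(i in [set` J]) (Z i @^-1` B i)) =
    (\prod_(i <- J) P (Z i @^-1` B i))%E.

(* [g] is a version of the conditional probability of the event [E] given the
   sub-sigma-algebra [F]. *)
Definition is_cond_prob (F : set (set Omega)) (E : set Omega)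
    (g : Omega -> R) : Prop :=
  [/\ forall B : set R, measurable B -> F (g @^-1` B),
      P.-integrable setT (EFin \o g) &
      forall A, F A -> (\int[P]_(omega in A) (g omega)%:E)%E = P (A `&` E)].

(* Products of conditional probabilities are defined up to null sets, hence the
   quantification over all versions [g]. *)
Definition cond_independent (F : set (set Omega))
    {d' : measure_display} {T : measurableType d'}
    (Z : nat -> Omega -> T) : Prop :=
  forall (J : {fset nat}) (B : nat -> set T) (g : nat -> Omega -> R),
    (forall i, measurable (B i)) ->
    (forall i, i \in J -> is_cond_prob F (Z i @^-1` B i) (g i)) ->
    is_cond_prob F (\bigcap_(i in [set` J]) (Z i @^-1` B i))
      (fun omega => \prod_(i <- J) g i omega).

End conditioning.

Section model.
Context {d : measure_display} {Omega : measurableType d} {R : realType}.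
Variable P : probability Omega R.
Variables (lambda p : nat -> {RV P >-> R}) (K X : nat -> {RV P >-> nat}).

Definition params (i : nat) (omega : Omega) : R * R :=
  (lambda i omega, p i omega).

Definition counts (i : nat) (omega : Omega) : nat * nat :=
  (K i omega, X i omega).

Definition params_sigma : set (set Omega) :=
  <<s \bigcup_i preimage_set_system setT (params i) measurable >>.

Definition params_count_sigma (i : nat) : set (set Omega) :=
  <<s params_sigma `|` preimage_set_system setT (K i) measurable >>.

Record poisson_binomial_model (G : probability (R * R)%type R) : Prop := {
  mixing_support : G [set x | 0 <= x.1 /\ 0 <= x.2 <= 1] = 1%E ;
  params_law : forall (i : nat) (B : set (R * R)), measurable B ->
    P (params i @^-1` B) = G B ;
  params_indep : mutually_independent P params ;
  K_cond_law : forall i k : nat,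
    is_cond_prob P params_sigma (K i @^-1` [set k])
      (fun omega => poisson_mass (lambda i omega) k) ;
  X_cond_law : forall i x : nat,
    is_cond_prob P (params_count_sigma i) (X i @^-1` [set x])
      (fun omega => binomial_pmf (K i omega) (p i omega) x) ;
  counts_cond_indep : cond_independent P params_sigma counts
}.

(* The truncated subtraction is harmless: [X i <= K i] almost surely. *)
Definition W (i : nat) (omega : Omega) : nat * nat :=
  (X i omega, (K i omega - X i omega)%N).

Definition xi (i : nat) (omega : Omega) : R * R :=
  (p i omega * lambda i omega, (1 - p i omega) * lambda i omega).

End model.

(* Main.v *)
(** Only the empirical frequencies of the observed pairs matter.  The pairs
    [W i] are i.i.d. with mass function [f_G = mixture Gxi], since a Poisson
    variable split by independent coin flips gives two independent Poisson
    variables; hence a.s. every frequency [q_n v] tends to [f_G v].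

    Let [f_n] be the mixture of the GMLE.  Moving from the GMLE towards [Gxi]
    cannot increase the likelihood, so [\sum_v q_n v * f_G v / f_n v <= 1].
    With [c_n := sqrt (q_n * f_G)], summing [(f_n - c_n)^2 / f_n] over a finite
    set [A] gives [(f_n v - c_n v)^2 <= 2 - 2 * \sum_A c_n] for [v] in [A], and
    the right-hand side tends to [2 - 2 * \sum_A f_G], which is small for large
    [A].  Hence [f_n] tends to [f_G] pointwise.

    Pointwise convergence of mixtures says that the integrals of
    [x^k y^l e^{-x-y}] converge.  Expanding [e^{-x/2}] in its Taylor series,
    which converges uniformly against [x^k e^{-sx}] for [s >= 1], yields the
    same for [x^k y^l e^{-sx-ty}] with [s, t] in [1 + N/2].  These contain the
    Poisson kernels of every integer scale, so bounded continuous functions can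
    be approximated on compact sets by Szasz operators, and the kernels of
    scale one give tightness.  Identifiability is the case of a constant
    sequence. *)

Require Import Defs.
From HB Require Import structures.
From mathcomp Require Import all_boot all_order all_algebra finmap.
From mathcomp Require Import all_classical all_reals all_analysis.
From mathcomp Require Import measurable_realfun ring lra.
Set Implicit Arguments.
Unset Strict Implicit.
Unset Printing Implicit Defensive.
Import Order.TTheory GRing.Theory Num.Theory.
Import numFieldNormedType.Exports.
Local Open Scope classical_set_scope.
Local Open Scope ring_scope.

(** * Poisson kernels *)

Section poisson_kernel.
Context {R : realType}.
Implicit Types (x y : R) (k n : nat).

Lemma is_derive_ge0_le (F F' : R -> R) y :
  (forall x, is_derive x 1 F (F' x)) ->
  (forall x, 0 <= x -> 0 <= F' x) -> 0 <= y -> F 0 <= F y.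
Proof.
move=> dF F'0; rewrite le_eqVlt => /predU1P[<-//|y0].
have [|c + eqF] := @MVT R F F' 0 y y0 (fun x _ => dF x).
  apply: continuous_subspaceT => x.
  by apply/differentiable_continuous/derivable1_diffP; exact: ex_derive.
rewrite in_itv/= => /andP[c0 _].
by rewrite -subr_ge0 eqF mulr_ge0 ?F'0 ?subr_ge0// ltW.
Qed.

Lemma poisson_mass_ge0 x k : 0 <= x -> 0 <= poisson_mass x k.
Proof.
by move=> x0; rewrite /poisson_mass divr_ge0// mulr_ge0 ?expR_ge0 ?exprn_ge0.
Qed.

Lemma poisson_mass_le1 x k : 0 <= x -> poisson_mass x k <= 1.
Proof.
move=> x0; rewrite /poisson_mass expRN -mulrA ler_pdivrMl ?expR_gt0// mulr1.
case: k => [|k]; first by rewrite expr0 fact0 divr1 -expR0 ler_expR.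
by apply: le_trans (expR_ge1Dxn k x0); rewrite lerDr.
Qed.

Lemma poisson_massS x k :
  k.+1%:R * poisson_mass x k.+1 = x * poisson_mass x k.
Proof.
rewrite /poisson_mass factS natrM exprS.
have h1 : k.+1%:R != 0 :> R by rewrite pnatr_eq0.
have h2 : k`!%:R != 0 :> R by rewrite pnatr_eq0 -lt0n fact_gt0.
by field; rewrite h2 addrC natr1 h1.
Qed.

(** Equals (-1)^n times the Taylor remainder of order n of e^{-y} ([expRN_remE]). In this recursive
    form each remainder is an antiderivative of the preceding one. *)
Fixpoint expRN_rem n y : R :=
  if n is m.+1 then y ^+ m / m`!%:R - expRN_rem m y else expR (- y).

Lemma expRN_remE n y : expRN_rem n y =
  (-1) ^+ n * (expR (- y) - \sum_(i < n) (- y) ^+ i / i`!%:R).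
Proof.
elim: n => [|n IHn] /=; first by rewrite big_ord0 subr0 expr0 mul1r.
rewrite IHn big_ord_recr/= exprS.
rewrite (_ : y ^+ n = (-1) ^+ n * (- y) ^+ n); first by ring.
by rewrite -exprMn mulN1r opprK.
Qed.

Lemma is_derive_expRN_rem n y :
  is_derive y 1 (expRN_rem n.+1) (expRN_rem n y).
Proof.
elim: n => [|n IHn].
  rewrite (_ : expRN_rem 1 = (cst (1 / 1) - (expR \o -%R))); last first.
    by apply/funext => x /=.
  have := @is_derive1_comp R expR -%R y _ _ (is_derive_expR (- y)) _.
  move=> /(_ (-1) (is_deriveNid _ _)) h.
  apply: is_derive_eq.
  by rewrite sub0r mulrN1 opprK.
rewrite (_ : expRN_rem n.+2 =
    (n.+1`!%:R^-1 *: ((@id R) ^+ n.+1) - expRN_rem n.+1)); last first.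
  by apply/funext => x; rewrite /= /GRing.scale/= exprfctE mulrC.
apply: is_derive_eq.
rewrite /= /GRing.scale/= factS natrM; congr (_ - _).
have h1 : n.+1%:R != 0 :> R by rewrite pnatr_eq0.
have h2 : n`!%:R != 0 :> R by rewrite pnatr_eq0 -lt0n fact_gt0.
rewrite -mulr_natl.
by field; rewrite h2 addrC natr1 h1.
Qed.

Lemma expRN_rem0 n : expRN_rem n.+1 0 = 0.
Proof.
elim: n => [|n IHn]; first by rewrite /= oppr0 expR0 expr0 fact0 divr1 subrr.
by rewrite [LHS]/= -/(expRN_rem n.+1 0) IHn expr0n mul0r subr0.
Qed.

(** By induction: for n > 0 the remainder vanishes at 0, and its derivative, the preceding
    remainder, is nonnegative on [0, oo). *)
Lemma expRN_rem_ge0 n y : 0 <= y -> 0 <= expRN_rem n y.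
Proof.
elim: n y => [|n IHn] y y0 /=; first exact: expR_ge0.
apply: le_trans (is_derive_ge0_le (is_derive_expRN_rem n) IHn y0).
by rewrite -/(expRN_rem n.+1 0) expRN_rem0.
Qed.

(** Nonnegativity of the remainder of index n + 1 is the upper bound y^n/n! on the remainder of
    index n. *)
Lemma expRN_taylor_le n y : 0 <= y ->
  `|expR (- y) - \sum_(i < n) (- y) ^+ i / i`!%:R| <= y ^+ n / n`!%:R.
Proof.
move=> y0; have := expRN_rem_ge0 n.+1 y0; rewrite /= subr_ge0; apply: le_trans.
by rewrite -[leRHS]ger0_norm ?expRN_rem_ge0// expRN_remE normrM normrX normrN1
  expr1n mul1r.
Qed.

(** An exact formula for the truncated variance: by the recursion [poisson_massS] the sum
    telescopes, leaving one boundary term at n. *)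
Lemma sum_poisson_mass_var x n :
  \sum_(k < n.+1) (k%:R - x) ^+ 2 * poisson_mass x k =
  x * (\sum_(k < n.+1) poisson_mass x k - (n.+1%:R - x) * poisson_mass x n).
Proof.
elim: n => [|n IHn].
  by rewrite !big_ord1 /=; ring.
rewrite big_ord_recr/= IHn [in RHS]big_ord_recr/=.
have := poisson_massS x n; rewrite -!natr1 => eqS.
rewrite !mulrBr !mulrDr.
rewrite (_ : x * ((n%:R + 1 - x) * poisson_mass x n) = 
 (n%:R + 1 - x) * (x * poisson_mass x n)); last by ring.
by rewrite -eqS; ring.
Qed.

Lemma cvg_sum_poisson_mass x :
  (\sum_(k < n) poisson_mass x k) @[n --> \oo] --> (1 : R).
Proof.
rewrite (_ : (fun n => _) = (fun n => expR (- x) * series (exp_coeff x) n)).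
  rewrite -(expRxMexpNx_1 x) mulrC; apply: cvgMr.
  exact: is_cvg_series_exp_coeff.
apply/funext => n; rewrite /series/= big_mkord mulr_sumr.
by apply: eq_bigr => i _; rewrite /poisson_mass mulrA.
Qed.

Lemma sum_poisson_mass_le1 x n : 0 <= x -> \sum_(k < n) poisson_mass x k <= 1.
Proof.
move=> x0; rewrite -(cvg_lim _ (@cvg_sum_poisson_mass x))//.
apply: nondecreasing_cvgn_le; last first.
  by apply/cvg_ex; exists 1; exact: cvg_sum_poisson_mass.
apply/nondecreasing_seqP => m; rewrite big_ord_recr/= lerDl.
exact: poisson_mass_ge0.
Qed.

Lemma sum_poisson_mass_var_le x n : 0 <= x ->
  \sum_(k < n) (k%:R - x) ^+ 2 * poisson_mass x k <= x.
Proof.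
move=> x0.
(* Summing further only adds nonnegative terms, and once the range passes x the boundary term of
   [sum_poisson_mass_var] has a favourable sign. *)
pose m := (maxn n (Num.truncn x).+1).
apply: (@le_trans _ _ (\sum_(k < m.+1) (k%:R - x) ^+ 2 * poisson_mass x k)).
  rewrite (big_ord_widen m.+1 (fun k => (k%:R - x) ^+ 2 * poisson_mass x k)).
    rewrite [leRHS](bigID (fun i : 'I__ => (i < n)%N))/= lerDl.
    by rewrite sumr_ge0// => i _; rewrite mulr_ge0 ?sqr_ge0 ?poisson_mass_ge0.
  by rewrite (leq_trans (leq_maxl _ _) (leqnSn m)).
rewrite sum_poisson_mass_var -[leRHS]mulr1 ler_wpM2l//.
rewrite -[leRHS]subr0 lerB ?sum_poisson_mass_le1// mulr_ge0 ?poisson_mass_ge0//.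
rewrite subr_ge0; apply: ltW; apply: lt_le_trans (truncnS_gt _) _.
by rewrite ler_nat /m (leq_trans (leq_maxr n _) (leqnSn _)).
Qed.

(** Chebyshev's inequality. The total mass 1 is written as a limit of partial sums, so that the
    finite variance bound is enough. *)
Lemma sum_poisson_mass_tail x n : 0 <= x -> x < n%:R ->
  1 - \sum_(k < n) poisson_mass x k <= x / (n%:R - x) ^+ 2.
Proof.
move=> x0 xn.
have nx0 : 0 < n%:R - x by rewrite subr_gt0.
rewrite lerBlDr -[X in X <= _](cvg_lim _ (@cvg_sum_poisson_mass x))//.
apply: limr_le; first by apply/cvg_ex; exists 1; exact: cvg_sum_poisson_mass.
near=> m.
have nm : (n <= m)%N by near: m; exact: nbhs_infty_ge.
rewrite -(subnKC nm) big_split_ord/= [leLHS]addrC lerD2r.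
rewrite ler_pdivlMr ?exprn_gt0//.
rewrite mulr_suml.
apply: le_trans (sum_poisson_mass_var_le (n + (m - n)) x0).
rewrite big_split_ord/= ler_wpDl//.
  by rewrite sumr_ge0// => i _; rewrite mulr_ge0 ?sqr_ge0 ?poisson_mass_ge0.
apply: ler_sum => i _; rewrite mulrC ler_wpM2r ?poisson_mass_ge0//.
have le_nx : n%:R - x <= (n + i)%:R - x by rewrite lerD2r ler_nat leq_addr.
by apply: lerXn2r => //; rewrite nnegrE ?(le_trans (ltW nx0))// ltW.
Unshelve. all: by end_near.
Qed.
End poisson_kernel.

(** * Functions whose integrals converge *)

Section tested.
Context {d : measure_display} {T : measurableType d} {R : realType}.
Variable D : set T.
Hypothesis mD : measurable D.
Implicit Types (f g : T -> R) (mu : probability T R).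

(** Such functions are integrable for every probability measure at once, so integrability need not
    be tracked along a sequence of measures. *)
Definition bounded_measurable f :=
  measurable_fun D f /\ exists M, forall x, D x -> `|f x| <= M.

Lemma bounded_measurable_integrable mu f :
  bounded_measurable f -> mu.-integrable D (EFin \o f).
Proof.
move=> [mf [M fM]]; apply: measurable_bounded_integrable => //.
  by rewrite (le_lt_trans (probability_le1 mu mD))// ltry.
exists M; split; first exact: num_real.
by move=> y My x Dx; exact: le_trans (fM _ Dx) (ltW My).
Qed.

Lemma bounded_measurable_cst (r : R) : bounded_measurable (cst r).
Proof. by split => //; exists `|r|. Qed.

Lemma bounded_measurableD f g :
  bounded_measurable f -> bounded_measurable g -> bounded_measurable (f \+ g).
Proof.
move=> [mf [M fM]] [mg [N gN]]; split; first exact: measurable_funD.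
by exists (M + N) => x Dx; rewrite (le_trans (ler_normD _ _))// lerD ?fM ?gN.
Qed.

Lemma bounded_measurableM f g :
  bounded_measurable f -> bounded_measurable g -> bounded_measurable (f \* g).
Proof.
move=> [mf [M fM]] [mg [N gN]]; split; first exact: measurable_funM.
by exists (M * N) => x Dx; rewrite /= normrM ler_pM ?fM ?gN.
Qed.

Lemma bounded_measurableZ (r : R) f :
  bounded_measurable f -> bounded_measurable (fun x => r * f x).
Proof. by apply: bounded_measurableM; exact: bounded_measurable_cst. Qed.

Lemma bounded_measurableB f g :
  bounded_measurable f -> bounded_measurable g -> bounded_measurable (f \- g).
Proof.
move=> bf /(bounded_measurableZ (- 1)) /(bounded_measurableD bf).
rewrite (_ : (f \+ _) = f \- g)//.
by apply/funext => x /=; rewrite mulN1r.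
Qed.

Lemma Rintegral_dist_le mu f g e : bounded_measurable f ->
  bounded_measurable g -> 0 <= e -> (forall x, D x -> `|f x - g x| <= e) ->
  `|\int[mu]_(x in D) f x - \int[mu]_(x in D) g x| <= e.
Proof.
move=> bf bg e0 fg; have bfg := bounded_measurableB bf bg.
rewrite -RintegralB//; [|exact: bounded_measurable_integrable..].
apply: (le_trans (le_normr_Rintegral _ _)) => //.
  exact: bounded_measurable_integrable bfg.
apply: (@le_trans _ _ (\int[mu]_(x in D) e)).
  apply: le_Rintegral => //.
    by apply: integrable_norm; exact: bounded_measurable_integrable bfg.
  exact/bounded_measurable_integrable/bounded_measurable_cst.
rewrite Rintegral_cst// ler_piMr// -lee_fin fineK ?probability_le1//.
exact: fin_num_measure.
Qed.

(** Both conclusions go through one induction, since additivity at each step requires the remaining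
    sum to be integrable. *)
Lemma Rintegral_sum mu (I : Type) (s : seq I) (f_ : I -> T -> R) :
  (forall i, bounded_measurable (f_ i)) ->
  bounded_measurable (fun x => \sum_(i <- s) f_ i x) /\
  \int[mu]_(x in D) (\sum_(i <- s) f_ i x) =
    \sum_(i <- s) \int[mu]_(x in D) f_ i x.
Proof.
move=> bf; elim: s => [|i s [bs IHs]].
  have -> : (fun x => \sum_(i <- [::]) f_ i x) = cst 0.
    by apply/funext => x; rewrite big_nil.
  by split; [exact: bounded_measurable_cst|rewrite big_nil Rintegral_cst ?mul0r].
have -> : (fun x => \sum_(j <- i :: s) f_ j x) =
    f_ i \+ (fun x => \sum_(j <- s) f_ j x).
  by apply/funext => x; rewrite big_cons.
split; first exact: bounded_measurableD.
rewrite big_cons -IHs -RintegralD//.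
- exact: bounded_measurable_integrable (bf i).
- exact: bounded_measurable_integrable bs.
Qed.

Section sequence.
Variables (mu_ : nat -> probability T R) (mu : probability T R).

(** The class of functions along which the measures converge. It is a vector space closed under
    uniform limits, and is enlarged step by step from the Poisson kernels of scale one. *)
Definition tested f := bounded_measurable f /\
  \int[mu_ n]_(x in D) f x @[n --> \oo] --> \int[mu]_(x in D) f x.

Lemma testedD f g : tested f -> tested g -> tested (f \+ g).
Proof.
move=> [bf cf] [bg cg]; split; first exact: bounded_measurableD.
have E (m : probability T R) : \int[m]_(x in D) (f \+ g) x =
    \int[m]_(x in D) f x + \int[m]_(x in D) g x.
  by rewrite RintegralD//; exact: bounded_measurable_integrable.
by rewrite E; under eq_fun do rewrite E; exact: cvgD.
Qed.

Lemma testedZ (r : R) f : tested f -> tested (fun x => r * f x).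
Proof.
move=> [bf cf]; split; first exact: bounded_measurableZ.
have E (m : probability T R) :
    \int[m]_(x in D) (r * f x) = r * \int[m]_(x in D) f x.
  by rewrite RintegralZl//; exact: bounded_measurable_integrable.
by rewrite E; under eq_fun do rewrite E; exact: cvgMr.
Qed.

Lemma tested0 : tested (cst 0).
Proof.
split; first exact: bounded_measurable_cst.
have E (m : probability T R) : \int[m]_(x in D) (cst 0 : T -> R) x = 0.
  by rewrite Rintegral_cst// mul0r.
by rewrite E; under eq_fun do rewrite E; exact: cvg_cst.
Qed.

Lemma tested_sum (I : Type) (s : seq I) (f_ : I -> T -> R) :
  (forall i, tested (f_ i)) -> tested (fun x => \sum_(i <- s) f_ i x).
Proof.
move=> tf; elim: s => [|i s IHs].
  by rewrite (_ : (fun _ => _) = cst 0); [exact: tested0|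
    apply/funext => x; rewrite big_nil].
rewrite (_ : (fun _ => _) = f_ i \+ (fun x => \sum_(i <- s) f_ i x)).
  exact: testedD.
by apply/funext => x; rewrite big_cons.
Qed.

(** Uniform closeness on [D] passes to the integrals with the same constant for every probability,
    so a three-term split of the error suffices. *)
Lemma tested_uniform f : bounded_measurable f ->
  (forall e : R, 0 < e ->
     exists2 g, tested g & forall x, D x -> `|f x - g x| <= e) ->
  tested f.
Proof.
move=> bf fg; split=> //; apply/cvgrPdist_le => e e0.
have e3 : 0 < e / 3 by rewrite divr_gt0.
have [g [bg /cvgrPdist_le cg] efg] := fg _ e3.
near=> n.
have := Rintegral_dist_le (mu_ n) bf bg (ltW e3) efg.
have := Rintegral_dist_le mu bf bg (ltW e3) efg.
have : `|\int[mu]_(x in D) g x - \int[mu_ n]_(x in D) g x| <= e / 3.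
  by near: n; exact: cg.
rewrite !ler_norml => /andP[? ?] /andP[? ?] /andP[? ?]; apply/andP; split; lra.
Unshelve. all: by end_near.
Qed.

End sequence.
End tested.

(** * Raising the exponential rate by one half *)

Section laplace_step.
Context {R : realType}.
Implicit Types (x s : R) (k n : nat).

(** Up to sign, the k-th derivative in [s] of the Laplace kernel e^{-sx}. *)
Definition laplace_mono k s x := x ^+ k * expR (- (s * x)).

Lemma measurable_laplace_mono k s : measurable_fun setT (laplace_mono k s).
Proof.
apply: measurable_funM => //; apply: measurableT_comp => //.
by apply: measurableT_comp => //; exact: measurable_funM.
Qed.

Lemma powM_expRN_le k x : 0 <= x -> x ^+ k * expR (- x) <= k`!%:R.
Proof.
move=> x0; have := poisson_mass_le1 k x0.
by rewrite /poisson_mass ler_pdivrMr ?ltr0n ?fact_gt0// mul1r mulrC.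
Qed.

Lemma laplace_mono_ge0 k s x : 0 <= x -> 0 <= laplace_mono k s x.
Proof. by move=> x0; rewrite mulr_ge0 ?exprn_ge0 ?expR_ge0. Qed.

Lemma laplace_mono_le k s x : 1 <= s -> 0 <= x ->
  laplace_mono k s x <= k`!%:R.
Proof.
move=> s1 x0; apply: le_trans (powM_expRN_le k x0).
by rewrite ler_wpM2l ?exprn_ge0// ler_expR lerN2 ler_peMl.
Qed.

(* The remainder is at most [x^k e^{-x} (x/2)^n/n!]; splitting [e^{-x}] into
   [e^{-x/4} e^{-3x/4}] makes it geometrically small uniformly in [x]. *)
Lemma laplace_mono_taylor k s x n : 1 <= s -> 0 <= x ->
  `|laplace_mono k (s + 2^-1) x
    - \sum_(i < n) ((- 2^-1) ^+ i / i`!%:R) * laplace_mono (k + i) s x|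
  <= (4 ^+ k * k`!%:R) * (2 / 3) ^+ n.
Proof.
move=> s1 x0.
have -> : \sum_(i < n) ((- 2^-1) ^+ i / i`!%:R) * laplace_mono (k + i) s x =
    laplace_mono k s x * \sum_(i < n) (- (x / 2)) ^+ i / i`!%:R.
  rewrite mulr_sumr; apply: eq_bigr => i _; rewrite /laplace_mono exprD.
  have -> : (- (x / 2)) = x * (- 2^-1) by ring.
  by rewrite exprMn; ring.
have -> : laplace_mono k (s + 2^-1) x = laplace_mono k s x * expR (- (x / 2)).
  rewrite /laplace_mono -mulrA -expRD; congr (_ * expR _); ring.
rewrite -mulrBr normrM (ger0_norm (laplace_mono_ge0 _ _ x0)).
apply: (@le_trans _ _ (x ^+ k * expR (- x) * ((x / 2) ^+ n / n`!%:R))).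
  apply: ler_pM => //; first exact: laplace_mono_ge0.
    by rewrite ler_wpM2l ?exprn_ge0// ler_expR lerN2 ler_peMl.
  by apply: expRN_taylor_le; rewrite divr_ge0.
have x4 : 0 <= x / 4 by rewrite divr_ge0.
have x3 : 0 <= 3 * x / 4 by rewrite divr_ge0// mulr_ge0.
(* The factor e^{-x/4} absorbs x^k = 4^k (x/4)^k. Writing x/2 as (2/3)(3x/4) turns the rest into
   (2/3)^n times a Poisson mass of rate 3x/4. *)
have -> : x ^+ k * expR (- x) * ((x / 2) ^+ n / n`!%:R) =
    (4 ^+ k * ((x / 4) ^+ k * expR (- (x / 4)))) *
    ((2 / 3) ^+ n * poisson_mass (3 * x / 4) n).
  rewrite /poisson_mass.
  have -> : - x = - (x / 4) + - (3 * x / 4) by field.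
  rewrite expRD.
  have -> : x ^+ k = 4 ^+ k * (x / 4) ^+ k.
    by rewrite -exprMn; congr (_ ^+ _); field.
  have -> : (x / 2) ^+ n = (2 / 3) ^+ n * (3 * x / 4) ^+ n.
    by rewrite -exprMn; congr (_ ^+ _); field.
  by ring.
apply: ler_pM.
- by rewrite mulr_ge0 ?mulr_ge0 ?exprn_ge0 ?expR_ge0.
- by rewrite mulr_ge0 ?exprn_ge0 ?poisson_mass_ge0.
- by rewrite ler_wpM2l ?exprn_ge0// powM_expRN_le.
- by rewrite ler_piMr ?exprn_ge0 ?poisson_mass_le1.
Qed.

Context {d : measure_display} {T : measurableType d}.
Variables (D : set T) (mu_ : nat -> probability T R) (mu : probability T R).
Hypothesis mD : measurable D.

Lemma bounded_measurable_laplace_mono (c : T -> R) k s :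
  measurable_fun D c -> (forall t, D t -> 0 <= c t) -> 1 <= s ->
  bounded_measurable D (fun t => laplace_mono k s (c t)).
Proof.
move=> mc c0 s1; split.
  by apply: (measurableT_comp (measurable_laplace_mono k s)).
exists k`!%:R => t Dt.
by rewrite ger0_norm ?laplace_mono_ge0 ?laplace_mono_le ?c0.
Qed.

(** Expanding e^{-c/2} gives a series in higher powers of [c] at the old rate [s], whose terms are
    tested by hypothesis; the convergence is uniform on [D]. The bounded factor [g] carries the
    other coordinate when the rates are raised one coordinate at a time. *)
Lemma tested_laplace_step (c g : T -> R) s :
  measurable_fun D c -> (forall t, D t -> 0 <= c t) ->
  bounded_measurable D g -> 1 <= s ->
  (forall k, tested D mu_ mu (fun t => laplace_mono k s (c t) * g t)) ->
  forall k, tested D mu_ mu (fun t => laplace_mono k (s + 2^-1) (c t) * g t).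
Proof.
move=> mc c0 bg s1 Hs k; apply: tested_uniform => //.
  apply: bounded_measurableM => //.
  by apply: bounded_measurable_laplace_mono => //; lra.
move=> e e0; have [_ [B gB]] := bg.
(* The prefactor of the Taylor bound times a bound on [g], made positive so that one can divide by
   it. *)
pose C := (4 ^+ k * k`!%:R) * (`|B| + 1).
have C0 : 0 < C.
  by rewrite mulr_gt0 ?ltr_pwDr// mulr_gt0 ?exprn_gt0// ltr0n fact_gt0.
have h : `|2 / 3 : R| < 1 by rewrite ger0_norm//; lra.
have [n nC] : exists n, (2 / 3 : R) ^+ n <= e / C.
  have /cvgrPdist_le/(_ (e / C)) := cvg_expr h.
  rewrite divr_gt0// => /(_ isT)[n _ /(_ n (leqnn _))] /=.
  by rewrite sub0r normrN ger0_norm ?exprn_ge0//; exists n.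
exists (fun t => \sum_(i < n)
    ((- 2^-1) ^+ i / i`!%:R) * (laplace_mono (k + i) s (c t) * g t)).
  by apply: tested_sum => // i; apply: testedZ.
move=> t Dt.
under eq_bigr do rewrite mulrA.
rewrite -mulr_suml -mulrBl normrM.
apply: (@le_trans _ _ ((4 ^+ k * k`!%:R) * (2 / 3) ^+ n * (`|B| + 1))).
  apply: ler_pM => //; first by apply: laplace_mono_taylor => //; exact: c0.
  by rewrite (le_trans (gB _ Dt))// (le_trans (ler_norm _))// lerDl.
by rewrite mulrAC -/C mulrC -ler_pdivlMr.
Qed.

End laplace_step.

(** * From mixtures to Poisson kernels of every integer scale *)

Section tested_poisson.
Context {R : realType}.
Implicit Types (H : probability (R * R)%type R) (w : nat * nat).

Lemma measurable_quadrant : measurable (@quadrant R).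
Proof.
rewrite (_ : quadrant = `[0, +oo[ `*` `[0, +oo[); first exact: measurableX.
by apply/seteqP; split => -[a b] /=; rewrite !in_itv/= !andbT.
Qed.

Lemma measurable_poisson_mass k : measurable_fun setT (@poisson_mass R ^~ k).
Proof.
apply: measurable_funM => //; apply: measurable_funM => //.
by apply: measurableT_comp => //; exact: measurableT_comp.
Qed.

Lemma measurable_poisson2 w : measurable_fun setT (@poisson2 R w).
Proof.
by apply: measurable_funM; apply: (measurableT_comp (measurable_poisson_mass _)).
Qed.

Lemma poisson2_ge0 w (x : R * R) : quadrant x -> 0 <= poisson2 w x.
Proof. by move=> [x1 x2]; rewrite mulr_ge0// poisson_mass_ge0. Qed.

Lemma poisson2_le1 w (x : R * R) : quadrant x -> poisson2 w x <= 1.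
Proof.
by move=> [x1 x2]; rewrite mulr_ile1 ?poisson_mass_ge0 ?poisson_mass_le1.
Qed.

(** The weight of the Szasz operator of order [m] at the node [w / m]. *)
Definition scaled_poisson2 (m : nat) w (x : R * R) : R :=
  poisson2 w (m%:R * x.1, m%:R * x.2).

Variables (H_ : nat -> probability (R * R)%type R).
Variable H : probability (R * R)%type R.
Let Q := @quadrant R.
Let mQ : measurable Q := measurable_quadrant.

(** The kernel of scale m is a multiple of x^k y^l e^{-mx-my}. The rate m is reached from the rate 1
    by 2(m - 1) steps of one half, taken first in the second coordinate and then in the first. *)
Lemma tested_scaled_poisson2 (m : nat) w : (0 < m)%N ->
  (forall w, mixture (H_ n) w @[n --> \oo] --> mixture H w) ->
  tested Q H_ H (scaled_poisson2 m w).
Proof.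
move=> m0 cvgH.
pose lap2 (k1 k2 j1 j2 : nat) (x : R * R) : R :=
  laplace_mono k1 (1 + j1%:R / 2) x.1 * laplace_mono k2 (1 + j2%:R / 2) x.2.
have ge1 (j : nat) : 1 <= 1 + j%:R / 2 :> R by rewrite lerDl divr_ge0.
have m1 : measurable_fun Q fst by exact: measurable_funTS.
have m2 : measurable_fun Q snd by exact: measurable_funTS.
have Q1 (x : R * R) : Q x -> 0 <= x.1 by case.
have Q2 (x : R * R) : Q x -> 0 <= x.2 by case.
have bm1 (k j : nat) :
    bounded_measurable Q (fun x => laplace_mono k (1 + j%:R / 2) x.1).
  exact: bounded_measurable_laplace_mono.
have bm2 (k j : nat) :
    bounded_measurable Q (fun x => laplace_mono k (1 + j%:R / 2) x.2).
  exact: bounded_measurable_laplace_mono.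
have succ (j : nat) : 1 + j.+1%:R / 2 = 1 + j%:R / 2 + 2^-1 :> R.
  by rewrite -natr1; field.
(* At rates (1, 1) these are the Poisson kernels themselves, up to factorials, and their integrals
   are the mixtures. *)
have t00 k1 k2 : tested Q H_ H (lap2 k1 k2 0 0).
  have -> : lap2 k1 k2 0 0 =
      fun x => (k1`!%:R * k2`!%:R) * poisson2 (k1, k2) x.
    apply/funext => x; rewrite /lap2 /laplace_mono /poisson2 /poisson_mass/=.
    have f0 k : k`!%:R != 0 :> R by rewrite pnatr_eq0 -lt0n fact_gt0.
    by rewrite mul0r addr0 !mul1r; field; rewrite !f0.
  apply: testedZ => //; split; last exact: cvgH.
  split; first exact: measurable_funTS (measurable_poisson2 _).
  exists 1 => x [x1 x2]; rewrite ger0_norm ?poisson2_ge0//.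
  exact: poisson2_le1.
have t0j : forall j k1 k2, tested Q H_ H (lap2 k1 k2 0 j).
  elim => [|j IHj] k1 k2 //.
  have := @tested_laplace_step _ _ _ Q H_ H mQ snd
    (fun x => laplace_mono k1 (1 + 0%:R / 2) x.1) (1 + j%:R / 2)
    m2 Q2 (bm1 _ _) (ge1 _).
  rewrite -succ /lap2 => /(_ _ k2).
  under eq_fun do rewrite mulrC.
  by apply=> k; under eq_fun do rewrite mulrC; exact: IHj.
have tjj : forall i j k1 k2, tested Q H_ H (lap2 k1 k2 i j).
  elim => [|i IHi] j k1 k2; first exact: t0j.
  have := @tested_laplace_step _ _ _ Q H_ H mQ fst
    (fun x => laplace_mono k2 (1 + j%:R / 2) x.2) (1 + i%:R / 2)
    m1 Q1 (bm2 _ _) (ge1 _).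
  by rewrite -succ /lap2 => /(_ _ k1); apply => k; exact: IHi.
have -> : scaled_poisson2 m w = fun x => (m%:R ^+ w.1 * m%:R ^+ w.2
    / (w.1`!%:R * w.2`!%:R)) * lap2 w.1 w.2 (m.-1).*2 (m.-1).*2 x.
  apply/funext => x; rewrite /scaled_poisson2 /lap2 /laplace_mono /poisson2.
  rewrite /poisson_mass/=.
  have f0 k : k`!%:R != 0 :> R by rewrite pnatr_eq0 -lt0n fact_gt0.
  have -> : 1 + (m.-1).*2%:R / 2 = m%:R :> R.
    by rewrite -{2}(prednK m0) -muln2 natrM mulfK// addrC natr1.
  by rewrite !exprMn; field; rewrite !f0.
exact: testedZ.
Qed.

End tested_poisson.

(** * Approximation by Szasz operators *)

Section szasz.
Context {R : realType}.
Implicit Types (x u : R * R) (f : R * R -> R) (m n : nat).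
Let Q := @quadrant R.

(** The bivariate Szasz-Mirakyan operator of order [m], truncated to [n] nodes per coordinate so
    that it is a finite combination of tested kernels. *)
Definition szasz f m n x : R := \sum_(i < n) \sum_(j < n)
  f (i%:R / m%:R, j%:R / m%:R) * scaled_poisson2 m (i : nat, j : nat) x.

(** The probability that two independent Poisson variables of rates m x.1 and m x.2 both stay below
    [n]. Its defect from 1 is the truncation error of [szasz]; for m = 1 it also serves as a smooth
    cutoff in the tightness argument. *)
Definition poisson2_mass m n x : R :=
  \sum_(i < n) \sum_(j < n) scaled_poisson2 m (i : nat, j : nat) x.

Let pm m n (y : R) : R := \sum_(i < n) poisson_mass (m%:R * y) i.

Lemma poisson2_massE m n x : poisson2_mass m n x = pm m n x.1 * pm m n x.2.
Proof.
rewrite /poisson2_mass /pm mulr_suml; apply: eq_bigr => i _.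
by rewrite mulr_sumr.
Qed.

Lemma poisson2_mass_ge0 m n x : Q x -> 0 <= poisson2_mass m n x.
Proof.
move=> [x1 x2]; rewrite poisson2_massE.
by rewrite mulr_ge0// sumr_ge0// => i _; rewrite poisson_mass_ge0 ?mulr_ge0.
Qed.

Lemma poisson2_mass_le1 m n x : Q x -> poisson2_mass m n x <= 1.
Proof.
move=> [x1 x2]; rewrite poisson2_massE mulr_ile1//.
- by rewrite sumr_ge0// => i _; rewrite poisson_mass_ge0 ?mulr_ge0.
- by rewrite sumr_ge0// => i _; rewrite poisson_mass_ge0 ?mulr_ge0.
- by rewrite sum_poisson_mass_le1 ?mulr_ge0.
- by rewrite sum_poisson_mass_le1 ?mulr_ge0.
Qed.

Lemma scaled_poisson2_ge0 m w x : Q x -> 0 <= scaled_poisson2 m w x.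
Proof. by move=> [x1 x2]; apply: poisson2_ge0; split; rewrite /= mulr_ge0. Qed.

Lemma szasz_le f m n M x : Q x -> 0 <= M -> (forall u, Q u -> `|f u| <= M) ->
  `|szasz f m n x| <= M.
Proof.
move=> Qx M0 fM; apply: le_trans (ler_norm_sum _ _ _) _.
apply: (@le_trans _ _ (M * poisson2_mass m n x)); last first.
  by rewrite ler_piMr// poisson2_mass_le1.
rewrite mulr_sumr; apply: ler_sum => i _.
apply: le_trans (ler_norm_sum _ _ _) _.
rewrite mulr_sumr; apply: ler_sum => j _.
rewrite normrM (ger0_norm (scaled_poisson2_ge0 _ _ Qx)).
by rewrite ler_wpM2r ?scaled_poisson2_ge0// fM//; split; rewrite /= divr_ge0.
Qed.

Lemma sum_scaled_var_le m n (y : R) : (0 < m)%N -> 0 <= y ->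
  \sum_(i < n) (i%:R / m%:R - y) ^+ 2 * poisson_mass (m%:R * y) i <= y / m%:R.
Proof.
move=> m0 y0; have m0R : 0 < m%:R :> R by rewrite ltr0n.
have -> : y / m%:R = (m%:R ^- 2) * (m%:R * y).
  by field; rewrite gt_eqF.
apply: (@le_trans _ _ (m%:R ^- 2 * \sum_(i < n)
    (i%:R - m%:R * y) ^+ 2 * poisson_mass (m%:R * y) i)).
  rewrite mulr_sumr; apply: ler_sum => i _; rewrite [leRHS]mulrA ler_wpM2r//.
    by rewrite poisson_mass_ge0// mulr_ge0.
  rewrite le_eqVlt; apply/orP; left; apply/eqP.
  by field; rewrite gt_eqF.
rewrite ler_wpM2l// ?invr_ge0 ?exprn_ge0//.
by rewrite sum_poisson_mass_var_le// mulr_ge0.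
Qed.

(* Away from [x] the oscillation is dominated by the variance of the kernel. *)
Lemma szasz_dist_le f m n (M e r : R) x : (0 < m)%N -> Q x ->
  0 <= M -> (forall u, Q u -> `|f u| <= M) -> 0 <= e -> 0 < r ->
  (forall u, Q u -> `|u.1 - x.1| < r -> `|u.2 - x.2| < r ->
    `|f u - f x| <= e) ->
  `|szasz f m n x - f x| <=
    e + (2 * M / r ^+ 2) * ((x.1 + x.2) / m%:R) + M * (1 - poisson2_mass m n x).
Proof.
move=> m0 Qx M0 fM e0 r0 fe.
pose c := 2 * M / r ^+ 2.
have c0 : 0 <= c by rewrite divr_ge0 ?exprn_ge0 ?mulr_ge0// ltW.
pose v (i j : nat) : R * R := (i%:R / m%:R, j%:R / m%:R).
have Qv i j : Q (v i j) by split; rewrite /= divr_ge0.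
pose a (i : nat) : R := poisson_mass (m%:R * x.1) i.
pose b (i : nat) : R := poisson_mass (m%:R * x.2) i.
have [x1 x2] := Qx.
have a0 i : 0 <= a i by rewrite poisson_mass_ge0 ?mulr_ge0.
have b0 i : 0 <= b i by rewrite poisson_mass_ge0 ?mulr_ge0.
(* If a coordinate of the node is at least r away from [x], then 2M = c r^2 is at most c times its
   squared deviation; otherwise the local bound e applies. *)
have far i j : `|f (v i j) - f x| <=
    e + (c * ((v i j).1 - x.1) ^+ 2 + c * ((v i j).2 - x.2) ^+ 2).
  have [v1|v1] := ltP `|(v i j).1 - x.1| r; last first.
    apply: (@le_trans _ _ (c * r ^+ 2)).
      rewrite /c mulfVK ?gt_eqF ?exprn_gt0//.
      rewrite (le_trans (ler_normB _ _))//.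
      by have := fM _ Qx; have := fM _ (Qv i j); lra.
    have : c * r ^+ 2 <= c * ((v i j).1 - x.1) ^+ 2.
      rewrite ler_wpM2l// -[leRHS]real_normK ?num_real//.
      by apply: lerXn2r => //; rewrite nnegrE ?ltW.
    have : 0 <= c * ((v i j).2 - x.2) ^+ 2 by rewrite mulr_ge0 ?sqr_ge0.
    lra.
  have [v2|v2] := ltP `|(v i j).2 - x.2| r; last first.
    apply: (@le_trans _ _ (c * r ^+ 2)).
      rewrite /c mulfVK ?gt_eqF ?exprn_gt0//.
      rewrite (le_trans (ler_normB _ _))//.
      by have := fM _ Qx; have := fM _ (Qv i j); lra.
    have : c * r ^+ 2 <= c * ((v i j).2 - x.2) ^+ 2.
      rewrite ler_wpM2l// -[leRHS]real_normK ?num_real//.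
      by apply: lerXn2r => //; rewrite nnegrE ?ltW.
    have : 0 <= c * ((v i j).1 - x.1) ^+ 2 by rewrite mulr_ge0 ?sqr_ge0.
    lra.
  have := fe _ (Qv i j) v1 v2.
  have : 0 <= c * ((v i j).1 - x.1) ^+ 2 by rewrite mulr_ge0 ?sqr_ge0.
  have : 0 <= c * ((v i j).2 - x.2) ^+ 2 by rewrite mulr_ge0 ?sqr_ge0.
  lra.
(* The truncated weights do not sum to one, so subtracting f x inside the sum leaves the missing
   mass as a separate term. *)
have -> : szasz f m n x - f x =
    \sum_(i < n) \sum_(j < n) (f (v i j) - f x) * (a i * b j) -
    f x * (1 - poisson2_mass m n x).
  have -> : \sum_(i < n) \sum_(j < n) (f (v i j) - f x) * (a i * b j) =
      szasz f m n x - f x * poisson2_mass m n x.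
    rewrite /szasz /poisson2_mass mulr_sumr -sumrB; apply: eq_bigr => i _.
    by rewrite mulr_sumr -sumrB; apply: eq_bigr => j _; rewrite mulrBl.
  by ring.
apply: le_trans (ler_normB _ _) _; apply: lerD; last first.
  rewrite normrM (@ger0_norm _ (1 - _)) ?subr_ge0 ?poisson2_mass_le1//.
  by rewrite ler_wpM2r ?fM// subr_ge0 poisson2_mass_le1.
pose v1 (i : nat) : R := (i%:R / m%:R - x.1) ^+ 2.
pose v2 (i : nat) : R := (i%:R / m%:R - x.2) ^+ 2.
apply: (@le_trans _ _ (\sum_(i < n) \sum_(j < n)
   (e + (c * v1 i + c * v2 j)) * (a i * b j))).
  apply: le_trans (ler_norm_sum _ _ _) _; apply: ler_sum => i _.
  apply: le_trans (ler_norm_sum _ _ _) _; apply: ler_sum => j _.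
  have ab0 : 0 <= a i * b j by rewrite mulr_ge0.
  by rewrite normrM (ger0_norm ab0) ler_wpM2r// far.
have -> : \sum_(i < n) \sum_(j < n) (e + (c * v1 i + c * v2 j)) * (a i * b j) =
   e * poisson2_mass m n x +
   c * ((\sum_(i < n) v1 i * a i) * (\sum_(j < n) b j) +
        (\sum_(i < n) a i) * (\sum_(j < n) v2 j * b j)).
  rewrite !big_distrlr/= -big_split/= !mulr_sumr -big_split/=.
  apply: eq_bigr => i _.
  rewrite -big_split/= !mulr_sumr -big_split/=; apply: eq_bigr => j _.
  by rewrite /scaled_poisson2 /poisson2 /= -/(a i) -/(b j); ring.
rewrite lerD//; first by rewrite ler_piMr// poisson2_mass_le1.
rewrite -/c ler_wpM2l// mulrDl.
have v1a : \sum_(i < n) v1 i * a i <= x.1 / m%:R by exact: sum_scaled_var_le.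
have v2b : \sum_(i < n) v2 i * b i <= x.2 / m%:R by exact: sum_scaled_var_le.
have s1 : \sum_(i < n) a i <= 1 by rewrite sum_poisson_mass_le1 ?mulr_ge0.
have s2 : \sum_(i < n) b i <= 1 by rewrite sum_poisson_mass_le1 ?mulr_ge0.
have s10 : 0 <= \sum_(i < n) a i by rewrite sumr_ge0.
have s20 : 0 <= \sum_(i < n) b i by rewrite sumr_ge0.
have va0 : 0 <= \sum_(i < n) v1 i * a i.
  by rewrite sumr_ge0// => i _; rewrite mulr_ge0 ?sqr_ge0.
have vb0 : 0 <= \sum_(i < n) v2 i * b i.
  by rewrite sumr_ge0// => i _; rewrite mulr_ge0 ?sqr_ge0.
rewrite lerD//.
  by rewrite (le_trans _ v1a)// ler_piMr.
by rewrite (le_trans _ v2b)// ler_piMl.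
Qed.

(** A Heine-Cantor statement in which only [x] is confined to the compact square: the Szasz nodes
    [u] may leave it. *)
Lemma uniform_continuous_square f (L e : R) :
  {within Q, continuous f} -> 0 < e ->
  exists2 r : R, 0 < r & forall x u, Q x -> x.1 <= L -> x.2 <= L -> Q u ->
    `|u.1 - x.1| < r -> `|u.2 - x.2| < r -> `|f u - f x| <= e.
Proof.
move=> /subspace_continuousP cf e0.
pose K := `[0, L]%classic `*` `[0, L]%classic : set (R * R).
have /compact_near_coveringP cK : compact K.
  by apply: compact_setX; exact: segment_compact.
(* The premise [Q x] is there because the covering property ranges over neighbourhoods in the plane,
   which may leave the quadrant. *)
pose P (r : R) (x : R * R) := Q x -> forall u, Q u ->
  `|u.1 - x.1| < r -> `|u.2 - x.2| < r -> `|f u - f x| <= e.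
have := cK R (0 : R)^'+ P _.
have : (forall x : R * R, K x ->
    \forall x' \near x & r \near (0 : R)^'+, P r x').
  move=> x [/=]; rewrite !in_itv/= => /andP[x10 _] /andP[x20 _].
  have Qx : Q x by [].
  have e2 : 0 < e / 2 by rewrite divr_gt0.
  have := cf x Qx => /cvgrPdist_le /(_ _ e2); rewrite near_withinE.
  rewrite near_simpl => /nbhs_ballP[r /= r0 xr].
  have r2 : 0 < r / 2 by rewrite divr_gt0.
  near=> x' r'.
  move=> /= Qx' u Qu u1 u2.
  have r'r : r' <= r / 2 by near: r'; exact: nbhs_right_le.
  have : ball x (r / 2) x' by near: x'; exact: nbhsx_ballx.
  move=> -[] /=; rewrite /ball/= => x1 x2.
  have fx' : `|f x - f x'| <= e / 2.
    by apply: xr => //; split;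
      rewrite /ball/= ?(lt_trans x1) ?(lt_trans x2)//; lra.
  have fu : `|f x - f u| <= e / 2.
    apply: xr => //; split; rewrite /ball/=.
      have -> : x.1 - u.1 = (x.1 - x'.1) - (u.1 - x'.1) by ring.
      by rewrite (le_lt_trans (ler_normB _ _))//; lra.
    have -> : x.2 - u.2 = (x.2 - x'.2) - (u.2 - x'.2) by ring.
    by rewrite (le_lt_trans (ler_normB _ _))//; lra.
  have -> : f u - f x' = (f x - f x') - (f x - f u) by ring.
  by apply: le_trans (ler_normB _ _) _; lra.
move=> /[swap] /[apply] near0.
have [r [r0 Kr]] : exists r : R, 0 < r /\ K `<=` P r.
  near (0 : R)^'+ => r; exists r; split; near: r; last exact: near0.
  exact: nbhs_right_gt.
exists r => // x u Qx x1 x2; apply: Kr => //.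
by split; rewrite /= in_itv/= ?x1 ?x2 andbT; case: Qx.
Unshelve. all: by end_near.
Qed.

Lemma poisson2_mass_cvg x (m : nat) :
  poisson2_mass m n x @[n --> \oo] --> (1 : R).
Proof.
under eq_fun do rewrite poisson2_massE.
have := cvgM (@cvg_sum_poisson_mass R (m%:R * x.1))
  (@cvg_sum_poisson_mass R (m%:R * x.2)).
by rewrite mulr1; exact.
Qed.

(** For each coordinate y, the two conditions on [n] give n - my >= 1 and n - my >= mL/r, so
    Chebyshev's bound my/(n - my)^2 is at most r. The two losses add up because 1 - ab <= (1 - a) +
    (1 - b) for a, b in [0, 1]. *)
Lemma poisson2_mass_tail m n (L r : R) x : Q x -> x.1 <= L -> x.2 <= L ->
  0 <= L -> 0 < r -> m%:R * L + 1 <= n%:R ->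
  m%:R * L / r + m%:R * L <= n%:R ->
  1 - poisson2_mass m n x <= 2 * r.
Proof.
move=> [x10 x20] x1 x2 L0 r0 n1 nr.
have tail (y : R) : 0 <= y -> y <= L -> 1 - pm m n y <= r.
  move=> y0 yL.
  have myL : m%:R * y <= m%:R * L by rewrite ler_wpM2l.
  have d1 : 1 <= n%:R - m%:R * y by lra.
  have d0 : 0 < n%:R - m%:R * y by lra.
  apply: le_trans (sum_poisson_mass_tail (n := n) (mulr_ge0 _ y0) _) _ => //.
    by lra.
  rewrite ler_pdivrMr ?exprn_gt0//.
  have mLr : m%:R * L <= r * (n%:R - m%:R * L).
    by rewrite [leRHS]mulrC -ler_pdivrMr//; lra.
  apply: (@le_trans _ _ (r * (n%:R - m%:R * y))).
    apply: (le_trans myL); apply: (le_trans mLr).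
    by rewrite ler_pM2l//; lra.
  rewrite ler_pM2l//.
  by rewrite expr2 ler_peMl// ltW.
have := tail _ x10 x1; have := tail _ x20 x2.
rewrite poisson2_massE.
have p1 : pm m n x.1 <= 1 by rewrite /pm sum_poisson_mass_le1 ?mulr_ge0.
have p2 : pm m n x.2 <= 1 by rewrite /pm sum_poisson_mass_le1 ?mulr_ge0.
have p10 : 0 <= pm m n x.1.
  by rewrite sumr_ge0// => i _; rewrite poisson_mass_ge0 ?mulr_ge0.
have p20 : 0 <= pm m n x.2.
  by rewrite sumr_ge0// => i _; rewrite poisson_mass_ge0 ?mulr_ge0.
nra.
Qed.

(** Each term of [szasz_dist_le] gets e/3: the radius comes from uniform continuity, then [m] makes
    the variance term small, and then [n] the truncation term. *)
Lemma szasz_approx f (L M e : R) : {within Q, continuous f} ->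
  (forall u, Q u -> `|f u| <= M) -> 0 <= L -> 0 < e ->
  exists m n, (0 < m)%N /\
    forall x, Q x -> x.1 <= L -> x.2 <= L -> `|szasz f m n x - f x| <= e.
Proof.
move=> cf fM L0 e0.
have M0 : 0 <= M.
  by apply: le_trans (fM (0, 0) _); rewrite ?normr_ge0//; split.
have e3 : 0 < e / 3 by rewrite divr_gt0.
have [r r0 fr] := uniform_continuous_square L cf e3.
have M1 : 0 < M + 1 by rewrite ltr_wpDl.
pose m := (Num.truncn (2 * M / r ^+ 2 * (2 * L) / (e / 3))).+1.
have m0 : (0 < m)%N by [].
(* With M + 1 in place of M the quotient is safe when M = 0, and M * (2 t) is still at most e/3. *)
pose t := e / 3 / (2 * (M + 1)).
have t0 : 0 < t by rewrite divr_gt0// mulr_gt0.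
pose n := maxn (Num.truncn (m%:R * L + 1)).+1
  (Num.truncn (m%:R * L / t + m%:R * L)).+1.
exists m, n; split=> // x Qx x1 x2.
apply: le_trans (szasz_dist_le n m0 Qx M0 fM (ltW e3) r0
  (fun u => fr x u Qx x1 x2)) _.
apply: (@le_trans _ _ (e / 3 + e / 3 + e / 3)); last by lra.
apply: lerD; first apply: lerD.
- by lra.
- have mgt : 2 * M / r ^+ 2 * (2 * L) / (e / 3) <= m%:R.
    by rewrite ltW// truncnS_gt.
  have m0R : 0 < m%:R :> R by rewrite ltr0n.
  rewrite mulrA ler_pdivrMr//.
  move: mgt; rewrite ler_pdivrMr//.
  rewrite [e / 3 * _]mulrC; apply: le_trans.
  rewrite ler_wpM2l//; last by lra.
  by rewrite divr_ge0 ?exprn_ge0 ?mulr_ge0// ltW.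
- have nlb : m%:R * L + 1 <= n%:R.
    rewrite ltW// (lt_le_trans (truncnS_gt _))// ler_nat leq_max leqnn//.
  have nlb2 : m%:R * L / t + m%:R * L <= n%:R.
    by rewrite ltW// (lt_le_trans (truncnS_gt _))// ler_nat leq_max leqnn orbT.
  have := poisson2_mass_tail Qx x1 x2 L0 t0 nlb nlb2 => le_t.
  apply: (@le_trans _ _ (M * (2 * t))); first by rewrite ler_wpM2l.
  rewrite /t.
  have -> : M * (2 * (e / 3 / (2 * (M + 1)))) = e / 3 * (M / (M + 1)).
    by field; rewrite gt_eqF.
  apply: ler_piMr; first exact: ltW.
  by rewrite ler_pdivrMr// mul1r; lra.
Qed.

Lemma measurable_scaled_poisson2 m w :
  measurable_fun setT (@scaled_poisson2 R m w).
Proof.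
apply: (measurableT_comp (measurable_poisson2 w)).
by apply: measurable_fun_pair; apply: measurable_funM.
Qed.

Lemma measurable_szasz f m n : measurable_fun Q (szasz f m n).
Proof.
apply: measurable_sum => i; apply: measurable_sum => j.
apply: measurable_funM => //.
exact: measurable_funTS (measurable_scaled_poisson2 _ _).
Qed.

(** Continuity is known only within [Q], so measurability is obtained from a pointwise limit: the
    k-th Szasz sum is within 1/(k+1) of [f] on the square of side k. *)
Lemma bounded_continuous_measurable f : {within Q, continuous f} ->
  (exists M : R, forall u, Q u -> `|f u| <= M) -> bounded_measurable Q f.
Proof.
move=> cf [M fM]; split; last by exists M.
have inv_gt0 (k : nat) : 0 < k.+1%:R^-1 :> R by [].
have /choice[mn mnP] (k : nat) : exists mn : nat * nat,
    forall x, Q x -> x.1 <= k%:R -> x.2 <= k%:R ->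
      `|szasz f mn.1 mn.2 x - f x| <= k.+1%:R^-1.
  have [m [n [_ h]]] := szasz_approx cf fM (ler0n R k) (inv_gt0 k).
  by exists (m, n).
apply: (@measurable_fun_cvg _ _ _ _ (fun k => szasz f (mn k).1 (mn k).2)).
  by move=> k; exact: measurable_szasz.
move=> x Qx; apply/cvgrPdist_le => e e0; near=> k.
rewrite distrC; apply: (le_trans (mnP k _ Qx _ _)).
- near: k; exact: nbhs_infty_ger.
- near: k; exact: nbhs_infty_ger.
- near: k; have /cvgrPdist_le/(_ _ e0) := @cvg_harmonic R.
  apply: filterS => k; by rewrite sub0r normrN ger0_norm ?harmonic_ge0.
Unshelve. all: by end_near.
Qed.

End szasz.

(** * Weak convergence and identifiability from mixtures *)

Lemma cvg_Rintegral_bounded {d} {T : measurableType d} {R : realType}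
    (mu : probability T R) (D : set T) (f_ : nat -> T -> R)
    (f : T -> R) (M : R) :
  measurable D -> (forall n, measurable_fun D (f_ n)) ->
  (forall n x, D x -> `|f_ n x| <= M) ->
  (forall x, D x -> f_ n x @[n --> \oo] --> f x) ->
  \int[mu]_(x in D) f_ n x @[n --> \oo] --> \int[mu]_(x in D) f x.
Proof.
move=> mD mf_ fM cf.
have mf : measurable_fun D f := measurable_fun_cvg mf_ cf.
have iM : mu.-integrable D (EFin \o cst M).
  exact/bounded_measurable_integrable/bounded_measurable_cst.
have [] := @dominated_convergence _ _ _ mu D mD (fun n => EFin \o f_ n)
  (EFin \o f) (EFin \o cst M).
- by move=> n; exact/measurable_EFinP.
- exact/measurable_EFinP.
- by apply: aeW => x Dx; apply: cvg_EFin; [exact: nearW|exact: cf].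
- exact: iM.
- by apply: aeW => x n Dx; rewrite /= lee_fin fM.
move=> intf _ cint; apply: fine_cvg; rewrite fineK//.
exact: integrable_fin_num.
Qed.

Section convergence.
Context {R : realType}.
Implicit Types (x u : R * R) (f : R * R -> R) (H : probability (R * R)%type R).
Let Q := @quadrant R.
Let mQ : measurable Q := measurable_quadrant.

Lemma measurable_poisson2_mass m n : measurable_fun Q (@poisson2_mass R m n).
Proof.
apply: measurable_sum => i; apply: measurable_sum => j.
exact: measurable_funTS (measurable_scaled_poisson2 _ _).
Qed.

Lemma bounded_measurable_poisson2_mass m n :
  bounded_measurable Q (@poisson2_mass R m n).
Proof.
split; first exact: measurable_poisson2_mass.
by exists 1 => x Qx; rewrite ger0_norm ?poisson2_mass_ge0 ?poisson2_mass_le1.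
Qed.

Lemma Rintegral_poisson2_mass_cvg H m : on_quadrant H ->
  \int[H]_(x in Q) poisson2_mass m n x @[n --> \oo] --> (1 : R).
Proof.
move=> HQ; have -> : 1 = \int[H]_(x in Q) (cst 1 : R * R -> R) x.
  by rewrite Rintegral_cst// mul1r; apply/esym; exact: (congr1 fine HQ).
apply: (@cvg_Rintegral_bounded _ _ _ H Q _ _ 1) => //.
- by move=> n; exact: measurable_poisson2_mass.
- by move=> n x Qx; rewrite ger0_norm ?poisson2_mass_ge0 ?poisson2_mass_le1.
- by move=> x Qx; exact: poisson2_mass_cvg.
Qed.

Lemma Rintegral_poisson2_mass H n :
  \int[H]_(x in Q) poisson2_mass 1 n x =
  \sum_(i < n) \sum_(j < n) mixture H (i : nat, j : nat).
Proof.
have bp w : bounded_measurable Q (@scaled_poisson2 R 1 w).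
  split; first exact: measurable_funTS (measurable_scaled_poisson2 _ _).
  exists 1 => x Qx; rewrite ger0_norm ?scaled_poisson2_ge0//.
  by case: Qx => x1 x2; apply: poisson2_le1; split; rewrite /= mul1r.
have [_ ->] := Rintegral_sum mQ H (index_enum 'I_n) (fun i =>
  (Rintegral_sum mQ H (index_enum 'I_n) (fun j => bp (i : nat, j : nat))).1).
apply: eq_bigr => i _.
rewrite (Rintegral_sum mQ H (index_enum 'I_n)
  (fun j => bp (i : nat, j : nat))).2.
apply: eq_bigr => j _; apply: eq_Rintegral => x _.
by rewrite /scaled_poisson2 !mul1r -surjective_pairing.
Qed.

(** By [poisson_massS] each Poisson mass below n at rate y is at most n/y, so all n of them sum to
    at most n^2/y. Hence the cutoff loses at least half of its mass outside a square. *)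
Lemma poisson2_mass_far n x : (0 < n)%N -> Q x ->
  (2 * n%:R ^+ 2 < x.1) || (2 * n%:R ^+ 2 < x.2) -> poisson2_mass 1 n x <= 2^-1.
Proof.
move=> n0 [x1 x2].
have n20 : 0 < 2 * n%:R ^+ 2 :> R by rewrite mulr_gt0 ?exprn_gt0 ?ltr0n.
pose p (y : R) := \sum_(i < n) poisson_mass (1 * y) i.
have p0 (y : R) : 0 <= y -> 0 <= p y.
  by move=> y0; rewrite sumr_ge0// => i _; rewrite mul1r poisson_mass_ge0.
have p1 (y : R) : 0 <= y -> p y <= 1.
  by move=> y0; rewrite sum_poisson_mass_le1// mul1r.
have far (y : R) : 2 * n%:R ^+ 2 < y -> p y <= 2^-1.
  move=> ny; have y0 : 0 < y by rewrite (lt_trans n20).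
  apply: (@le_trans _ _ (\sum_(i < n) (n%:R / y))).
    apply: ler_sum => i _; rewrite mul1r ler_pdivlMr// mulrC -poisson_massS.
    apply: (@le_trans _ _ (i.+1%:R)).
      by rewrite ler_piMr// poisson_mass_le1// ltW.
    by rewrite ler_nat.
  rewrite sumr_const card_ord -[leLHS]mulr_natr mulrAC -expr2.
  by rewrite ler_pdivrMr//; lra.
rewrite poisson2_massE -/(p x.1) -/(p x.2) => /orP[/far p1x|/far p2x].
  by apply: le_trans p1x; rewrite ler_piMr ?p0 ?p1.
by apply: le_trans p2x; rewrite ler_piMl ?p0 ?p1.
Qed.

(* The mixtures of [H] and [H_ n] determine the integrals of the functions
   [szasz f m k], and the mass left out by [poisson2_mass 1 N] controls the
   integral of [f] away from a compact square. *)
Lemma mixture_cvg_weakly (H_ : nat -> probability (R * R)%type R) H :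
  on_quadrant H ->
  (forall w, mixture (H_ n) w @[n --> \oo] --> mixture H w) ->
  weakly_converges H_ H.
Proof.
move=> HQ cvgH f cf [M0 fM0].
pose M : R := `|M0| + 1.
have M_gt0 : 0 < M by rewrite ltr_pwDr.
have fM u : Q u -> `|f u| <= M.
  by move=> Qu; rewrite (le_trans (fM0 _ Qu))// (le_trans (ler_norm _))// lerDl.
have bf : bounded_measurable Q f.
  by apply: bounded_continuous_measurable => //; exists M0.
suff near_le (e : R) : 0 < e -> \forall n \near \oo,
    `|\int[H]_(x in Q) f x - \int[H_ n]_(x in Q) f x| <= e.
  exact/cvgrPdist_le.
(* Here a and b are the integrals of the cutoff under [H_ n] and [H]. The defects 1 - b <= t and 1 -
   a <= 2t cost e/8 and e/4, and the three other errors e/8 each. *)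
have tail_arith (t a b If If' Ig Ig' : R) : t * M = e / 32 -> 1 - t <= b ->
    `|b - a| <= t -> `|Ig - Ig'| <= e / 8 ->
    `|If - Ig| <= e / 8 + 4 * M * (1 - b) ->
    `|If' - Ig'| <= e / 8 + 4 * M * (1 - a) -> `|If - If'| <= e.
  rewrite !ler_norml => tM b1 /andP[? ?] /andP[? ?] /andP[? ?] /andP[? ?].
  have : M * (1 - a) <= M * (2 * t) by rewrite ler_pM2l//; lra.
  have : M * (1 - b) <= M * t by rewrite ler_pM2l//; lra.
  by move=> ? ?; apply/andP; split; lra.
move=> e0; pose t : R := e / (32 * M).
have t0 : 0 < t by rewrite divr_gt0// mulr_gt0.
have [N N0 NH] : exists2 N, (0 < N)%N &
    1 - t <= \int[H]_(x in Q) poisson2_mass 1 N x.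
  have /cvgrPdist_le/(_ _ t0)[N _ NP] := Rintegral_poisson2_mass_cvg 1 HQ.
  exists N.+1 => //; have := NP N.+1 (leqnSn N).
  by rewrite ler_norml => /andP[_]; rewrite /Q/=; lra.
have e8 : 0 < e / 8 by rewrite divr_gt0.
have L0 : 0 <= 2 * N%:R ^+ 2 :> R by rewrite mulr_ge0 ?exprn_ge0.
have [m [k [m0 fmk]]] := szasz_approx cf fM L0 e8.
pose g := szasz f m k.
have tp mm w : (0 < mm)%N -> tested Q H_ H (scaled_poisson2 mm w).
  by move=> mm0; exact: tested_scaled_poisson2.
have tg : tested Q H_ H g.
  apply: tested_sum => // i; apply: tested_sum => // j.
  by apply: testedZ => //; exact: tp.
have tm : tested Q H_ H (poisson2_mass 1 N).
  by apply: tested_sum => // i; apply: tested_sum => // j; exact: tp.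
(* In the square the Szasz bound applies. Outside it f - g is at most 2M, and the cutoff is at most
   1/2, so 4M times its defect dominates. *)
have dist x : Q x ->
    `|f x - g x| <= e / 8 + 4 * M * (1 - poisson2_mass 1 N x).
  move=> Qx; have q1 := poisson2_mass_le1 1 N Qx.
  have [far|] := boolP ((2 * N%:R ^+ 2 < x.1) || (2 * N%:R ^+ 2 < x.2)).
    have q2 := poisson2_mass_far N0 Qx far.
    apply: (@le_trans _ _ (M + M)).
      by rewrite (le_trans (ler_normB _ _))// lerD ?fM// szasz_le// ltW.
    have : M * (2 * (1 - 2^-1)) <= M * (2 * (1 - poisson2_mass 1 N x)).
      by rewrite ler_pM2l//; lra.
    by lra.
  rewrite negb_or -!leNgt => /andP[x1 x2].
  rewrite distrC (le_trans (fmk _ Qx x1 x2))// lerDl.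
  by rewrite !mulr_ge0// ?subr_ge0// ltW.
(* Stated for every [K], as it is applied both to [H] and to [H_ n]; the bound K Q <= 1 is what
   enters. *)
have dist_int (K : probability (R * R)%type R) :
    `|\int[K]_(x in Q) f x - \int[K]_(x in Q) g x| <=
    e / 8 + 4 * M * (1 - \int[K]_(x in Q) poisson2_mass 1 N x).
  have bfg := bounded_measurableB bf tg.1.
  have bm := bounded_measurable_poisson2_mass 1 N.
  have b1 := bounded_measurableB (bounded_measurable_cst Q 1) bm.
  have bb := bounded_measurableD (bounded_measurable_cst Q (e / 8))
    (bounded_measurableZ (4 * M) b1).
  have int h : bounded_measurable Q h -> K.-integrable Q (EFin \o h).
    exact: bounded_measurable_integrable.
  rewrite -RintegralB//; [|exact: int|exact: int tg.1].
  apply: (le_trans (le_normr_Rintegral _ _)) => //.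
    exact: int bfg.
  apply: (le_trans (le_Rintegral _ _ _ dist)) => //.
  - by apply: integrable_norm; exact: int bfg.
  - exact: int bb.
  rewrite RintegralD//; [|exact: int (bounded_measurable_cst Q _)|
    exact: int (bounded_measurableZ (4 * M) b1)].
  have i1 : K.-integrable Q (EFin \o (fun x => 1 - poisson2_mass 1 N x)).
    exact: int _ b1.
  rewrite (RintegralZl _ mQ i1).
  rewrite RintegralB//; [|exact: int (bounded_measurable_cst Q _)|
    exact: int bm].
  have KQ1 : fine (K Q) <= 1.
    by rewrite -lee_fin fineK ?probability_le1//; exact: fin_num_measure.
  have KQ0 : 0 <= fine (K Q) by rewrite fine_ge0.
  rewrite !Rintegral_cst// mul1r lerD//.
    by rewrite ler_piMr// ltW.
  by rewrite ler_wpM2l ?mulr_ge0// ?lerD2r// ltW.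
have /cvgrPdist_le/(_ _ e8) cg := tg.2.
have /cvgrPdist_le/(_ _ t0) cm := tm.2.
near=> n.
have tM : t * M = e / 32 by rewrite /t; field; rewrite gt_eqF.
apply: (tail_arith t (\int[H_ n]_(x in Q) poisson2_mass 1 N x)
  (\int[H]_(x in Q) poisson2_mass 1 N x) _ _
  (\int[H]_(x in Q) g x) (\int[H_ n]_(x in Q) g x)) => //.
- by near: n; exact: cm.
- by near: n; exact: cg.
Unshelve. all: by end_near.
Qed.

Lemma measure_quadrantI H A : on_quadrant H -> measurable A ->
  H (A `&` Q) = H A.
Proof.
move=> HQ mA; have HQC : H (~` Q) = 0%E.
  by rewrite probability_setC// (HQ : H Q = 1%E) subee.
rewrite [in RHS](measureDI H mA mQ) [X in (X + _)%E](_ : _ = 0%E) ?add0e//.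
apply: (@subset_measure0 _ _ _ H _ (~` Q)) => //.
  exact: measurableD.
exact: measurableC.
Qed.

(** Products of two such sets form a pi-system generating the Borel sets of the plane; the whole
    line leaves a coordinate free. *)
Definition open_ray (A : set R) : Prop :=
  A = setT \/ exists a, A = `]-oo, a[%classic.

Lemma open_ray_approx (A : set R) : open_ray A ->
  exists phi : nat -> R -> R, [/\ forall n, continuous (phi n),
    forall n y, 0 <= phi n y <= 1 &
    forall y, phi n y @[n --> \oo] --> (\1_A y : R)].
Proof.
move=> [->|[a ->]].
  exists (fun=> cst 1); split => [n|n y|y].
  - by move=> y; exact: cst_continuous.
  - by rewrite /= ler01 lexx.
  - by rewrite indicT; exact: cvg_cst.
(* For n > 0, a ramp that vanishes from a on and reaches 1 at distance 1/n below a. *)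
exists (fun n y => Num.min 1 (Num.max 0 (n%:R * (a - y)))); split.
- move=> n y; pose g z : R^o := n%:R * (a - z).
  have cg : {for y, continuous g}.
    by apply: cvgM; [exact: cvg_cst|apply: cvgB; [exact: cvg_cst|exact: cvg_id]].
  apply: (@continuous_min _ _ (cst 1) (cst 0 \max g)).
    exact: cst_continuous.
  by apply: continuous_max; first exact: cst_continuous.
- by move=> n y; rewrite le_min ler01 le_max lexx/= ge_min lexx.
- move=> y; rewrite indicE; have [ya|ay] := ltP y a.
    rewrite mem_set/= ?in_itv//=.
    apply: cvg_near_cst; near=> n.
    have ay0 : 0 < a - y by rewrite subr_gt0.
    have n1 : 1 <= n%:R * (a - y).
      by rewrite -ler_pdivrMr//; near: n; exact: nbhs_infty_ger.
    by rewrite max_r ?(le_trans ler01)// min_l.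
  rewrite memNset/= ?in_itv//=; last by apply/negP; rewrite -leNgt.
  apply: cvg_near_cst; apply: nearW => n.
  rewrite max_l; last by rewrite mulr_ge0_le0// subr_le0.
  by rewrite min_r.
Unshelve. all: by end_near.
Qed.

(** Both projections are measurable for the generated sigma-algebra, hence so is their pairing,
    which is the identity map into the Borel plane. *)
Lemma measurable_open_rays (A : set (R * R)) : measurable A ->
  <<s [set B1 `*` B2 | B1 in open_ray & B2 in open_ray] >> A.
Proof.
set C := [set B1 `*` B2 | B1 in open_ray & B2 in open_ray] => mA.
pose T := g_sigma_algebraType C.
have mfst : measurable_fun setT (fst : T -> R).
  apply: (measurability _ (RGenInftyO.measurableE R)) => _ [_ [a ->] <-].
  rewrite setTI; apply: sub_sigma_algebra.
  exists `]-oo, a[%classic; first by right; exists a.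
  exists setT; first by left.
  by apply/seteqP; split => x /=; [case|].
have msnd : measurable_fun setT (snd : T -> R).
  apply: (measurability _ (RGenInftyO.measurableE R)) => _ [_ [a ->] <-].
  rewrite setTI; apply: sub_sigma_algebra.
  exists setT; first by left.
  exists `]-oo, a[%classic; first by right; exists a.
  by apply/seteqP; split => x /=; [case|].
have := measurable_fun_pair mfst msnd measurableT mA.
rewrite setTI.
have -> // : (fun x : T => (x.1, x.2)) @^-1` A = A.
by apply/seteqP; split => -[].
Qed.

(** Indicators of products of rays are bounded pointwise limits of continuous functions, so the
    measures agree on a generating pi-system. *)
Lemma continuous_eq_measure H H' : on_quadrant H -> on_quadrant H' ->
  (forall f, {within Q, continuous f} ->
    (exists M : R, forall u, Q u -> `|f u| <= M) ->
    \int[H]_(x in Q) f x = \int[H']_(x in Q) f x) ->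
  forall A : set (R * R), measurable A -> H A = H' A.
Proof.
move=> HQ HQ' eqHH' A mA.
set C := [set B1 `*` B2 | B1 in open_ray & B2 in open_ray].
have mray B : open_ray B -> measurable B.
  by move=> [->|[a ->]]; [exact: measurableT|exact: measurable_itv].
have mC B : C B -> measurable B.
  by move=> [B1 /mray mB1 [B2 /mray mB2 <-]]; exact: measurableX.
have rayI B B' : open_ray B -> open_ray B' -> open_ray (B `&` B').
  move=> [->|[a ->]] rB'; first by rewrite setTI.
  case: rB' => [->|[b ->]]; first by rewrite setIT; right; exists a.
  right; exists (Num.min a b); apply/seteqP; split => y /=;
    rewrite !in_itv/= lt_min; last by case/andP.
  by move=> [-> ->].
apply: (measure_unique C (fun=> setT)) => //.
- apply/seteqP; split; first exact: measurable_open_rays.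
  apply: smallest_sub; [exact: sigma_algebra_measurable|exact: mC].
- move=> _ _ [B1 rB1 [B2 rB2 <-]] [D1 rD1 [D2 rD2 <-]].
  exists (B1 `&` D1); first exact: rayI.
  by exists (B2 `&` D2); [exact: rayI|rewrite setXI].
- by move=> _; exists setT; [left|exists setT; [left|rewrite setXTT]].
- by rewrite bigcup_const//; exists 0%N.
- move=> B CB; have mB := mC _ CB.
  apply: (etrans (esym (measure_quadrantI HQ mB))).
  apply: (etrans _ (measure_quadrantI HQ' mB)).
  have [B1 /open_ray_approx[phi1 [c1 b1 l1]]] := CB.
  move=> [B2 /open_ray_approx[phi2 [c2 b2 l2]] B12].
  pose f n (x : R * R) := phi1 n x.1 * phi2 n x.2.
  have cf n : continuous (f n).
    move=> x; apply: cvgM.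
      by apply: (@continuous_comp _ _ _ fst (phi1 n));
        [exact: cvg_fst|exact: c1].
    by apply: (@continuous_comp _ _ _ snd (phi2 n));
      [exact: cvg_snd|exact: c2].
  have f01 n x : `|f n x| <= 1.
    have /andP[? ?] := b1 n x.1; have /andP[? ?] := b2 n x.2.
    by rewrite ger0_norm ?mulr_ge0// mulr_ile1.
  have fcw n : {within Q, continuous (f n)} by exact: continuous_subspaceT.
  have fb n : exists M : R, forall u, Q u -> `|f n u| <= M by exists 1.
  have cvgf (K : probability (R * R)%type R) :
      \int[K]_(x in Q) f n x @[n --> \oo] --> \int[K]_(x in Q) \1_B x.
    apply: (@cvg_Rintegral_bounded _ _ _ K Q _ _ 1) => //.
      by move=> n; have [] := bounded_continuous_measurable (fcw n) (fb n).
    move=> x _; rewrite -B12.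
    have -> : \1_(B1 `*` B2) x = \1_B1 x.1 * \1_B2 x.2 :> R.
      by rewrite !indicE in_setX; case: (_ \in B1); rewrite ?mul1r ?mul0r.
    by apply: cvgM; [exact: l1|exact: l2].
  have := cvgf H'; under eq_fun do rewrite -eqHH'//.
  move=> /(cvg_unique _ (cvgf H)).
  rewrite /Rintegral !integral_indic// => e.
  rewrite -[LHS]fineK ?fin_num_measure//; last exact: measurableI.
  rewrite -[RHS]fineK ?fin_num_measure//; last exact: measurableI.
  by congr EFin; exact: e.
- by move=> _; rewrite (le_lt_trans (probability_le1 H measurableT))// ltry.
Qed.

Lemma on_quadrant_identifiable H : on_quadrant H -> identifiable H.
Proof.
move=> HQ H' HQ' eqm; apply: continuous_eq_measure => // f cf bf.
have := @mixture_cvg_weakly (fun=> H') H HQ _ f cf bf.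
have h w : mixture H' w @[_ --> \oo] --> mixture H w.
  by rewrite eqm; exact: cvg_cst.
by move=> /(_ h) /(cvg_unique _ (cvg_cst _)) ->.
Qed.

End convergence.

(** * Generalized maximum likelihood *)

Section convex_combination.
Context {d : measure_display} {T : measurableType d} {R : realType}.
Variables (a b : {nonneg R}) (ab1 : a%:num + b%:num = 1).
Variables (H G : probability T R).

(** The dummy [let] makes [ab1] a parameter of the definition, so that the probability instance,
    whose total mass depends on it, can be attached. *)
Definition convex_probability : set T -> \bar R :=
  let _ := ab1 in measure_add (mscale a H) (mscale b G).

HB.instance Definition _ := Measure.on convex_probability.

Lemma convex_probabilityE A :
  convex_probability A = (a%:num%:E * H A + b%:num%:E * G A)%E.
Proof. by rewrite /convex_probability measure_addE. Qed.

Let convex_probability_setT : convex_probability setT = 1%E.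
Proof.
by rewrite convex_probabilityE !probability_setT !mule1 -EFinD ab1.
Qed.

HB.instance Definition _ := Measure_isProbability.Build _ _ _
  convex_probability convex_probability_setT.

Lemma ge0_integral_convex_probability D (f : T -> \bar R) :
  measurable D -> measurable_fun D f -> (forall x, D x -> (0 <= f x)%E) ->
  (\int[convex_probability]_(x in D) f x =
  a%:num%:E * \int[H]_(x in D) f x + b%:num%:E * \int[G]_(x in D) f x)%E.
Proof.
move=> mD mf f0; rewrite ge0_integral_measure_add//.
by rewrite !ge0_integral_mscale.
Qed.

End convex_combination.

(** The tangent at t = 0 with a quadratic error. The condition on [x] keeps every factor
    nonnegative, so the inductive bound can be multiplied. *)
Lemma prod1D_ge {R : realType} (n : nat) (x : 'I_n -> R) :
  (forall i, -1 <= x i) ->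
  exists2 C : R, 0 <= C & forall t, 0 <= t <= 1 ->
    1 + t * (\sum_i x i) - C * t ^+ 2 <= \prod_i (1 + t * x i).
Proof.
elim: n x => [|n IHn] x x1.
  exists 0 => // t _; rewrite !big_ord0; lra.
have [C C0 HC] := IHn (fun i => x (widen_ord (leqnSn n) i)) (fun i => x1 _).
set S := \sum_(i < n) _ in HC.
(* Multiplying the inductive bound by 1 + t y, with y the last entry, produces the extra terms S y
   t^2 and - C y t^3, which the last two summands absorb. *)
exists (C + C * `|x ord_max| + `|S * x ord_max|).
  by rewrite !addr_ge0// mulr_ge0.
move=> t t01; have /andP[t0 t1] := t01; rewrite !big_ord_recr/= -/S.
have := HC t t01; set P := \prod_(i < n) _ => HP.
set y := x ord_max; have y1 : -1 <= y by exact: x1.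
have ty : 0 <= 1 + t * y by nra.
apply: (@le_trans _ _ ((1 + t * S - C * t ^+ 2) * (1 + t * y))); last first.
  by rewrite ler_wpM2r.
rewrite -subr_ge0.
have -> : (1 + t * S - C * t ^+ 2) * (1 + t * y) -
    (1 + t * (S + y) - (C + C * `|y| + `|S * y|) * t ^+ 2) =
    t ^+ 2 * ((S * y + `|S * y|) + C * (`|y| - t * y)) by ring.
rewrite mulr_ge0 ?sqr_ge0// addr_ge0//.
  by have := ler_norm (- (S * y)); rewrite normrN; lra.
rewrite mulr_ge0// subr_ge0 (le_trans (ler_norm _))// normrM ger0_norm//.
by rewrite ler_piMl.
Qed.

(** The sum is the derivative of the product at t = 0, where the value 1 is maximal. *)
Lemma prod1D_le1_sum {R : realType} (n : nat) (x : 'I_n -> R) :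
  (forall i, -1 <= x i) ->
  (forall t, 0 < t <= 1 -> \prod_i (1 + t * x i) <= 1) -> \sum_i x i <= 0.
Proof.
move=> x1 prod1; have [C C0 HC] := prod1D_ge x1.
set S := \sum_i x i in HC *; rewrite leNgt; apply/negP => S0.
(* This choice gives t <= 1 and C t < S, so the linear gain exceeds the quadratic error. *)
pose t := S / (C + S + 1).
have D0 : 0 < C + S + 1 by rewrite ltr_wpDl// addr_ge0// ltW.
have t0 : 0 < t by rewrite divr_gt0.
have t1 : t <= 1 by rewrite ler_pdivrMr//; lra.
have := prod1 t; rewrite t0 t1 => /(_ isT).
have := HC t; rewrite (ltW t0) t1 => /(_ isT) h1 h2.
have h3 : t * S <= t * (C * t).
  by have := le_trans h1 h2; rewrite expr2; lra.
move: h3; rewrite ler_pM2l// => h3.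
have h4 : t * (C + S + 1) = S by rewrite /t divfK// gt_eqF.
nra.
Qed.

Section GMLE.
Context {R : realType}.
Implicit Types (H G : probability (R * R)%type R).
Implicit Types (w : nat -> nat * nat) (v : nat * nat).
Let Q := @quadrant R.
Let mQ : measurable Q := measurable_quadrant.

Lemma mixture_ge0 H v : 0 <= mixture H v.
Proof. by apply: Rintegral_ge0 => x; exact: poisson2_ge0. Qed.

Lemma bounded_measurable_poisson2 v : bounded_measurable Q (@poisson2 R v).
Proof.
split; first exact: measurable_funTS (measurable_poisson2 v).
by exists 1 => x Qx; rewrite ger0_norm ?poisson2_ge0 ?poisson2_le1.
Qed.

Lemma mixtureE H v : (mixture H v)%:E = (\int[H]_(x in Q) (poisson2 v x)%:E)%E.
Proof.
rewrite /mixture /Rintegral fineK//; apply: integrable_fin_num => //.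
exact: bounded_measurable_integrable (bounded_measurable_poisson2 v).
Qed.

Lemma mixture_convex (a b : {nonneg R}) (ab1 : a%:num + b%:num = 1) H G v :
  mixture (convex_probability ab1 H G) v =
  a%:num * mixture H v + b%:num * mixture G v.
Proof.
apply: EFin_inj; rewrite mixtureE ge0_integral_convex_probability//.
- by rewrite EFinD !EFinM !mixtureE.
- by apply/measurable_EFinP; exact: (bounded_measurable_poisson2 v).1.
- by move=> x Qx; rewrite lee_fin poisson2_ge0.
Qed.

Lemma Rintegral_le1 H (f : R * R -> R) : bounded_measurable Q f ->
  (forall x, Q x -> f x <= 1) -> \int[H]_(x in Q) f x <= 1.
Proof.
move=> bf f1; apply: (@le_trans _ _ (\int[H]_(x in Q) 1)).
  apply: le_Rintegral => //; first exact: bounded_measurable_integrable.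
  exact: bounded_measurable_integrable (bounded_measurable_cst _ _).
rewrite Rintegral_cst// mul1r -lee_fin fineK ?probability_le1//.
exact: fin_num_measure.
Qed.

Lemma sum_mixture_le1 H n :
  \sum_(i < n) \sum_(j < n) mixture H (i : nat, j : nat) <= 1.
Proof.
rewrite -Rintegral_poisson2_mass; apply: Rintegral_le1.
  exact: bounded_measurable_poisson2_mass.
by move=> x; exact: poisson2_mass_le1.
Qed.

Lemma mixture_le1 H v : mixture H v <= 1.
Proof.
apply: Rintegral_le1; first exact: bounded_measurable_poisson2.
by move=> x; exact: poisson2_le1.
Qed.

(** The point mass at (1, 1) gives positive probability to every pair of counts, so the maximal
    likelihood is positive and none of its factors vanishes. *)
Lemma GMLE_mixture_gt0 n w H (i : 'I_n) : is_GMLE n w H -> 0 < mixture H (w i).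
Proof.
move=> [HQ Hmax]; rewrite lt0r mixture_ge0 andbT.
pose D : probability (R * R)%type R := \d_((1, 1) : (R * R)%type).
have dQ : on_quadrant D.
  by rewrite /on_quadrant /D /= /dirac indicE mem_set//; split; exact: ler01.
apply/eqP => wi0; have := Hmax _ dQ.
rewrite [X in _ <= X](bigD1 i)//= wi0 mul0r leNgt => /negP; apply.
apply: prodr_gt0 => j _; rewrite -lte_fin mixtureE integral_dirac//=; last first.
  by apply/measurable_EFinP; exact: (bounded_measurable_poisson2 _).1.
rewrite diracE mem_set/= ?mul1e; last by split; rewrite /= ler01.
by rewrite lte_fin !mulr_gt0 ?expR_gt0 ?expr1n ?invr_gt0 ?ltr0n ?fact_gt0.
Qed.

(* The likelihood of [(1 - t) H + t G] is maximal at [t = 0]. *)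
Lemma GMLE_ratio_le n w H G : is_GMLE n w H -> on_quadrant G ->
  \sum_(i < n) mixture G (w i) / mixture H (w i) <= n%:R.
Proof.
move=> gH GQ; have [HQ Hmax] := gH.
have H0 i : 0 < mixture H (w (i : 'I_n)) := GMLE_mixture_gt0 i gH.
(* The relative increment: moving a fraction t from [H] to [G] multiplies the i-th factor of the
   likelihood by 1 + t x_i. *)
pose x (i : 'I_n) := mixture G (w i) / mixture H (w i) - 1.
have : \sum_i x i <= 0.
  apply: prod1D_le1_sum => [i|t /andP[t0 t1]].
    by rewrite /x lerBrDr addNr divr_ge0 ?mixture_ge0.
  have s0 : 0 <= 1 - t by rewrite subr_ge0.
  have ab1 : (NngNum s0)%:num + (NngNum (ltW t0))%:num = 1 :> R.
    by rewrite /= subrK.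
  pose K : probability (R * R)%type R := convex_probability ab1 H G.
  have KQ : on_quadrant K.
    apply: (etrans (convex_probabilityE ab1 H G Q)).
    by rewrite HQ GQ !mule1 -EFinD ab1.
  have := Hmax _ KQ.
  have -> : \prod_(i < n) mixture K (w i) =
      (\prod_(i < n) (1 + t * x i)) * \prod_(i < n) mixture H (w i).
    rewrite -big_split/=; apply: eq_bigr => i _.
    rewrite mixture_convex/= /x; field; exact: lt0r_neq0.
  by rewrite ger_pMl// prodr_gt0.
rewrite /x sumrB sumr_const card_ord subr_le0.
by [].
Qed.

Definition frequency n w v : R := (\sum_(k < n) (w k == v)%:R) / n%:R.

Lemma frequency_ge0 n w v : 0 <= frequency n w v.
Proof. by rewrite divr_ge0// sumr_ge0. Qed.

(** [GMLE_ratio_le] with the observations grouped by value. Those outside the N by N window are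
    dropped, which only lowers the sum since the ratios are nonnegative. *)
Lemma sum_frequency_ratio_le n w H G N : (0 < n)%N ->
  is_GMLE n w H -> on_quadrant G ->
  \sum_(i < N) \sum_(j < N) frequency n w (i : nat, j : nat) *
    (mixture G (i : nat, j : nat) / mixture H (i : nat, j : nat)) <= 1.
Proof.
move=> n0 gH GQ; have n0R : 0 < n%:R :> R by rewrite ltr0n.
pose r v := mixture G v / mixture H v.
have r0 v : 0 <= r v by rewrite divr_ge0 ?mixture_ge0.
rewrite pair_big/= -/(r _).
have -> : \sum_(p : 'I_N * 'I_N) frequency n w (p.1 : nat, p.2 : nat) *
    r (p.1 : nat, p.2 : nat) =
    (\sum_(k < n) \sum_(p : 'I_N * 'I_N)
      (w k == (p.1 : nat, p.2 : nat))%:R * r (w k)) / n%:R.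
  rewrite exchange_big/= mulr_suml; apply: eq_bigr => p _.
  rewrite /frequency mulrAC mulr_suml; congr (_ / _); apply: eq_bigr => k _.
  by have [->//|] := eqVneq (w k); rewrite !mul0r.
rewrite ler_pdivrMr// mul1r.
apply: le_trans (GMLE_ratio_le gH GQ); apply: ler_sum => k _.
rewrite -mulr_suml -/(r (w k)) ler_piMl//.
have [[p /eqP wkp]|nop] :=
    pselect (exists p : 'I_N * 'I_N, w k == (p.1 : nat, p.2 : nat)).
  rewrite (bigD1 p)//= wkp eqxx big1 ?addr0// => q qp.
  apply/eqP; rewrite pnatr_eq0 eqb0; apply: contraNneq qp => -[e1 e2].
  by rewrite [q]surjective_pairing [p]surjective_pairing; apply/eqP;
    congr (_, _); exact: val_inj.
rewrite big1// => p _; apply/eqP; rewrite pnatr_eq0 eqb0; apply/negP => wkp.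
by apply: nop; exists p.
Qed.

(** The summand of the Hellinger affinity between the empirical law and the mixture of [G]. *)
Definition frequency_gmean n w G v : R :=
  Num.sqrt (frequency n w v * mixture G v).

Lemma GMLE_dist n w H G N (i j : 'I_N) : (0 < n)%N ->
  is_GMLE n w H -> on_quadrant G ->
  (mixture H (i : nat, j : nat) - frequency_gmean n w G (i : nat, j : nat)) ^+ 2
  <= 2 - 2 * \sum_(i < N) \sum_(j < N) frequency_gmean n w G (i : nat, j : nat).
Proof.
move=> n0 gH GQ; pose c := frequency_gmean n w G.
rewrite -/(c _).
pose q v := frequency n w v; pose f v := mixture H v; pose g v := mixture G v.
have term v : (f v - c v) ^+ 2 <= f v - 2 * c v + q v * (g v / f v).
  have qg0 : 0 <= q v * g v by rewrite mulr_ge0 ?frequency_ge0 ?mixture_ge0.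
  have c2 : c v ^+ 2 = q v * g v by rewrite sqr_sqrtr.
  (* A value of mixture zero was not observed, so its frequency vanishes too. Otherwise f <= 1
     permits dividing the square by f, and c^2 = q g turns it into the right-hand side. *)
  have [fv0|fv0] := eqVneq (f v) 0.
    have qv0 : q v = 0.
      rewrite /q /frequency big1 ?mul0r// => k _.
      have [wkv|//] := eqVneq (w k) v.
      by have := GMLE_mixture_gt0 k gH; rewrite wkv -/(f v) fv0 ltxx.
    rewrite /c /frequency_gmean -/(q v) qv0 fv0.
    by rewrite !mul0r sqrtr0 mulr0 !subr0 addr0 expr0n.
  have f0 : 0 < f v by rewrite lt0r fv0 mixture_ge0.
  apply: (@le_trans _ _ ((f v - c v) ^+ 2 / f v)).
    by rewrite ler_pdivlMr// ler_piMr ?sqr_ge0// mixture_le1.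
  rewrite le_eqVlt; apply/orP; left; apply/eqP.
  rewrite mulrA -c2; by field.
pose v (p : 'I_N * 'I_N) : nat * nat := (p.1 : nat, p.2 : nat).
apply: (@le_trans _ _ (\sum_p (f (v p) - c (v p)) ^+ 2)).
  rewrite (bigD1 (i, j))//= lerDl sumr_ge0// => p _; exact: sqr_ge0.
apply: (@le_trans _ _ (\sum_p
  (f (v p) - 2 * c (v p) + q (v p) * (g (v p) / f (v p))))).
  by apply: ler_sum => p _; exact: term.
rewrite big_split/= sumrB -mulr_sumr.
have := sum_mixture_le1 H N; have := sum_frequency_ratio_le N n0 gH GQ.
rewrite !pair_big/= -/(v _).
move=> h1 h2.
have h1' : \sum_p q (v p) * (g (v p) / f (v p)) <= 1 by exact: h1.
have h2' : \sum_p f (v p) <= 1 by exact: h2.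
rewrite /v/= in h1' h2' *; lra.
Qed.

Lemma GMLE_mixture_cvg (H_ : nat -> probability (R * R)%type R) w G :
  on_quadrant G -> (forall n, (0 < n)%N -> is_GMLE n w (H_ n)) ->
  (forall v, frequency n w v @[n --> \oo] --> mixture G v) ->
  forall v, mixture (H_ n) v @[n --> \oo] --> mixture G v.
Proof.
move=> GQ gH cvgq v.
pose c n v := frequency_gmean n w G v.
have cvgc u : c n u @[n --> \oo] --> mixture G u.
  have -> : mixture G u = Num.sqrt (mixture G u * mixture G u).
    by rewrite -expr2 sqrtr_sqr ger0_norm ?mixture_ge0.
  apply: (cvg_comp (fun n => frequency n w u * mixture G u) Num.sqrt).
    by apply: cvgMl; exact: cvgq.
  exact: sqrt_continuous.
suff near_le (e : R) : 0 < e -> \forall n \near \oo,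
    `|mixture G v - mixture (H_ n) v| <= e.
  exact/cvgrPdist_le.
(* Truncating to the window and passing to the limit each lose t, so the bound of [GMLE_dist] is at
   most 4t = (e/2)^2. *)
move=> e0; pose t : R := e ^+ 2 / 16.
have t0 : 0 < t by rewrite divr_gt0// exprn_gt0.
have [N [vN GN]] : exists N, (v.1 < N)%N && (v.2 < N)%N /\
    1 - t <= \sum_(i < N) \sum_(j < N) mixture G (i : nat, j : nat).
  have /cvgrPdist_le/(_ _ t0)[N _ NP] := Rintegral_poisson2_mass_cvg 1 GQ.
  pose m := maxn N (maxn v.1 v.2).+1.
  exists m; split.
    by rewrite /m !leq_max !ltnS !leq_max !leqnn !orbT.
  have := NP m (leq_maxl _ _).
  by rewrite -Rintegral_poisson2_mass ler_norml => /andP[_]; rewrite /Q/=; lra.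
have cvgS : \sum_(i < N) \sum_(j < N) c n (i : nat, j : nat) @[n --> \oo] -->
    \sum_(i < N) \sum_(j < N) mixture G (i : nat, j : nat).
  apply: cvg_big => [|i _]; first exact: add_continuous.
  by apply: cvg_big => [|j _]; [exact: add_continuous|exact: cvgc].
have e2 : 0 < e / 2 by rewrite divr_gt0.
have /cvgrPdist_le/(_ _ t0) near1 := cvgS.
have /cvgrPdist_le/(_ _ e2) near2 := cvgc v.
near=> n.
have n0 : (0 < n)%N by near: n; exact: nbhs_infty_gt.
have /andP[v1 v2] := vN.
have h2 : `|\sum_(i < N) \sum_(j < N) mixture G (i : nat, j : nat) -
    \sum_(i < N) \sum_(j < N) c n (i : nat, j : nat)| <= t.
  by near: n; exact: near1.
pose S : R := \sum_(i < N) \sum_(j < N) mixture G (i : nat, j : nat).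
pose S' : R := \sum_(i < N) \sum_(j < N) c n (i : nat, j : nat).
have h1 : `|mixture G v - c n v| <= e / 2 by near: n; exact: near2.
rewrite -/S -/S' in h2.
have h3 : (mixture (H_ n) v - c n v) ^+ 2 <= 2 - 2 * S'.
  have := GMLE_dist (Ordinal v1) (Ordinal v2) n0 (gH n n0) GQ.
  by rewrite /= -surjective_pairing.
have {}h3 : (mixture (H_ n) v - c n v) ^+ 2 <= (e / 2) ^+ 2.
  apply: (le_trans h3); move: h2; rewrite ler_norml /t => /andP[? ?].
  have -> : (e / 2) ^+ 2 = 4 * (e ^+ 2 / 16) by field.
  rewrite /t -/S in GN; lra.
have {}h3 : `|mixture (H_ n) v - c n v| <= e / 2.
  rewrite -(@ler_pXn2r _ 2) ?nnegrE ?normr_ge0 ?(ltW e2)//.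
  by rewrite real_normK ?num_real.
have -> : mixture G v - mixture (H_ n) v =
  (mixture G v - c n v) - (mixture (H_ n) v - c n v) by ring.
by apply: le_trans (ler_normB _ _) _; lra.
Unshelve. all: by end_near.
Qed.

End GMLE.

(** * A strong law for pairwise independent events *)

Section strong_law.
Context {d : measure_display} {T : measurableType d} {R : realType}.
Variable P : probability T R.

(** By monotone convergence the sum of the series is integrable, hence finite almost everywhere, and
    the terms of a convergent series tend to 0. *)
Lemma summable_integrals_cvg0 (f : nat -> T -> R) (C : R) :
  (forall m, measurable_fun setT (f m)) -> (forall m t, 0 <= f m t) ->
  (forall n, (\sum_(m < n) \int[P]_t (f m t)%:E <= C%:E)%E) ->
  {ae P, forall t, f m t @[m --> \oo] --> (0 : R)}.
Proof.
move=> mf f0 fC.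
pose g t := (\sum_(m <oo) (f m t)%:E)%E.
have mfE m : measurable_fun setT (fun t => (f m t)%:E) by exact/measurable_EFinP.
have g0 t : (0 <= g t)%E by apply: nneseries_ge0 => m _ _; rewrite lee_fin.
have intg : (\int[P]_t g t <= C%:E)%E.
  rewrite integral_nneseries//; last by move=> m t _; rewrite lee_fin.
  apply: lime_le.
    by apply: is_cvg_nneseries => m _ _;
      apply: integral_ge0 => t _; rewrite lee_fin.
  by apply: nearW => n; rewrite big_mkord.
have ig : P.-integrable setT g.
  apply/integrableP; split.
    by apply: ge0_emeasurable_sum => // m t _ _; rewrite lee_fin.
  under eq_integral do rewrite gee0_abs//.
  by rewrite (le_lt_trans intg)// ltry.
have := integrable_ae measurableT ig; apply: filterS => t /(_ I) gt.
apply: cvg_series_cvg_0; apply: nondecreasing_is_cvgn.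
  apply/nondecreasing_seqP => n.
  by rewrite /series/= big_nat_recr//= lerDl.
exists (fine (g t)) => _ [n _ <-].
rewrite -lee_fin fineK// /series/= -sumEFin.
by apply: nneseries_lim_ge => m _; rewrite lee_fin.
Qed.

Lemma sum_inv_sqr_le (n : nat) : \sum_(m < n) (m.+1%:R ^- 2 : R) <= 2.
Proof.
(* Strengthened so that the induction closes: 1/(n+1)^2 is at most 2/(n+1) - 2/(n+2). *)
suff : \sum_(m < n) (m.+1%:R ^- 2 : R) <= 2 - 2 / n.+1%:R.
  by move=> /le_trans; apply; rewrite gerBl divr_ge0.
elim: n => [|n IHn]; first by rewrite big_ord0 divr1 subrr.
rewrite big_ord_recr/=; apply: (le_trans (lerD IHn (lexx _))).
rewrite -subr_ge0.
have n1 : 0 < n.+1%:R :> R by rewrite ltr0n.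
have n2 : 0 < n.+2%:R :> R by rewrite ltr0n.
have -> : 2 - 2 / n.+2%:R - (2 - 2 / n.+1%:R + n.+1%:R ^- 2) =
    (n%:R : R) / (n.+1%:R ^+ 2 * n.+2%:R).
  have e1 : n.+1%:R = n%:R + 1 :> R by rewrite natr1.
  have e2 : n.+2%:R = n%:R + 2 :> R by rewrite -[n.+2]addn2 natrD.
  rewrite e2 e1 in n1 n2 *; field; by rewrite !gt_eqF.
by rewrite divr_ge0// mulr_ge0// ?exprn_ge0// ltW.
Qed.

Lemma sqrt_interval (n : nat) : exists m, (m ^ 2 <= n < m.+1 ^ 2)%N.
Proof.
elim: n => [|n [m /andP[mn nm]]]; first by exists 0%N.
have [nm1|nm1] := ltnP n.+1 (m.+1 ^ 2).
  by exists m; rewrite nm1 (leq_trans mn).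
exists m.+1; rewrite nm1/= (leq_ltn_trans nm)//.
by rewrite ltn_sqr.
Qed.

Variables (E : nat -> set T) (q : R).
Hypothesis mE : forall i, measurable (E i).
Hypothesis PE : forall i, P (E i) = q%:E.
Hypothesis PEE : forall i j, i != j -> P (E i `&` E j) = (q ^+ 2)%:E.

Let S n t : R := \sum_(k < n) \1_(E k) t.

Let bm_indic (A : set T) : measurable A ->
  bounded_measurable setT (\1_A : T -> R).
Proof.
move=> mA; split; first exact: measurable_indic.
by exists 1 => t _; rewrite indicE ger0_norm// lern1 leq_b1.
Qed.

Let bm_prod i j : bounded_measurable setT
  (fun t => (\1_(E i) t - q) * (\1_(E j) t - q) : R).
Proof.
apply: bounded_measurableM.
  by apply: bounded_measurableB; [exact: bm_indic|exact: bounded_measurable_cst].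
by apply: bounded_measurableB; [exact: bm_indic|exact: bounded_measurable_cst].
Qed.

Let covariance_indic i j :
  \int[P]_t ((\1_(E i) t - q) * (\1_(E j) t - q)) =
  if i == j then q * (1 - q) else 0.
Proof.
have mEE : measurable (E i `&` E j) by exact: measurableI.
have int f : bounded_measurable setT f -> P.-integrable setT (EFin \o f).
  exact: bounded_measurable_integrable.
have bi A mA := int _ (@bm_indic A mA).
have int_indic A : measurable A -> \int[P]_t (\1_A t) = fine (P A).
  by move=> mA; rewrite /Rintegral integral_indic// setIT.
transitivity (fine (P (E i `&` E j)) - q ^+ 2).
  transitivity (\int[P]_t (\1_(E i `&` E j) t +
      ((- q) * \1_(E i) t + ((- q) * \1_(E j) t + q ^+ 2)) : R)).
    apply: eq_Rintegral => t _.
    by rewrite indicI/=; ring.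
  have b1 k : bounded_measurable setT (fun t => (- q) * \1_(E k) t : R).
    by apply: bounded_measurableZ; exact: bm_indic.
  have bc := bounded_measurable_cst (T := T) setT (q ^+ 2).
  have b2 := bounded_measurableD (b1 j) bc.
  have b3 := bounded_measurableD (b1 i) b2.
  rewrite (RintegralD measurableT (bi _ mEE) (int _ b3)).
  rewrite (RintegralD measurableT (int _ (b1 i)) (int _ b2)).
  rewrite (RintegralD measurableT (int _ (b1 j)) (int _ bc)).
  rewrite (RintegralZl _ measurableT (bi _ (mE i))).
  rewrite (RintegralZl _ measurableT (bi _ (mE j))).
  rewrite !int_indic// !PE/= Rintegral_cst//.
  rewrite [fine (_ setT)](_ : _ = 1); first by ring.
  exact: (congr1 fine (probability_setT P)).
have [->|ij] := eqVneq i j; first by rewrite setIid PE/=; ring.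
by rewrite PEE//= subrr.
Qed.

Let variance_S n : \int[P]_t (S n t - n%:R * q) ^+ 2 = n%:R * (q * (1 - q)).
Proof.
transitivity (\int[P]_t (\sum_(i < n) \sum_(j < n)
    (\1_(E i) t - q) * (\1_(E j) t - q))).
  apply: eq_Rintegral => t _.
  have -> : S n t - n%:R * q = \sum_(i < n) (\1_(E i) t - q).
    by rewrite sumrB sumr_const card_ord mulr_natl.
  by rewrite expr2 big_distrlr.
have [_ ->] := Rintegral_sum measurableT P (index_enum 'I_n) (fun i =>
  (Rintegral_sum measurableT P (index_enum 'I_n) (fun j => bm_prod i j)).1).
under eq_bigr => i _.
  rewrite (Rintegral_sum measurableT P (index_enum 'I_n)
    (fun j => bm_prod i j)).2.
  under eq_bigr do rewrite covariance_indic.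
  rewrite (bigD1 i)//= eqxx big1 ?addr0; last first.
    by move=> j ji; rewrite val_eqE eq_sym (negbTE ji).
  over.
by rewrite sumr_const card_ord mulr_natl.
Qed.

Let S_diff k n t : (k <= n)%N -> 0 <= S n t - S k t <= n%:R - k%:R.
Proof.
move=> kn; rewrite -(subnKC kn) /S big_split_ord/= addrAC subrr add0r.
rewrite natrD addrAC subrr add0r sumr_ge0//=.
apply: (@le_trans _ _ (\sum_(i < n - k) 1)); last by rewrite sumr_const card_ord.
by apply: ler_sum => i _; rewrite indicE lern1 leq_b1.
Qed.

(** Averages of n indicators have variance q(1 - q)/n, which is summable along n = m^2. Between
    consecutive squares the monotone counts keep the average within O(1/m). *)
Lemma strong_law_indic :
  {ae P, forall t, (\sum_(k < n) \1_(E k) t) / n%:R @[n --> \oo] --> q}.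
Proof.
pose f m t := (S (m.+1 ^ 2) t / (m.+1 ^ 2)%:R - q) ^+ 2.
have q01 : 0 <= q <= 1.
  by rewrite -!lee_fin -(PE 0%N) measure_ge0 probability_le1.
have mS n : measurable_fun setT (S n).
  by apply: measurable_sum => k; exact: measurable_indic.
have mf m : measurable_fun setT (f m).
  apply: measurable_funX; apply: measurable_funB => //.
  exact: measurable_funM.
have S0 n t : 0 <= S n t by rewrite sumr_ge0.
have Sn n t : S n t <= n%:R.
  apply: (@le_trans _ _ (\sum_(k < n) 1)); last by rewrite sumr_const card_ord.
  by apply: ler_sum => k _; rewrite indicE lern1 leq_b1.
have q1 : q * (1 - q) <= 1 by nra.
have fint m : (\int[P]_t (f m t)%:E <= (m.+1%:R ^- 2)%:E)%E.
  pose c : R := (m.+1 ^ 2)%:R.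
  have c0 : 0 < c by rewrite ltr0n expn_gt0.
  have bS n : bounded_measurable setT (fun t => (S n t - n%:R * q) ^+ 2).
    have b1 : bounded_measurable setT (fun t => S n t - n%:R * q).
      apply: bounded_measurableB; last exact: bounded_measurable_cst.
      by split => //; exists n%:R => t _; rewrite ger0_norm.
    exact: (bounded_measurableM b1 b1).
  have -> : (\int[P]_t (f m t)%:E = (\int[P]_t f m t)%:E)%E.
    rewrite /Rintegral fineK//; apply: integrable_fin_num => //.
    apply: bounded_measurable_integrable => //.
    have -> : f m = fun t => c ^- 2 * (S (m.+1 ^ 2) t - c * q) ^+ 2.
      by apply/funext => t; rewrite /f -/c; field; rewrite gt_eqF.
    exact: bounded_measurableZ.
  rewrite lee_fin.
  have -> : \int[P]_t f m t =
      \int[P]_t (c ^- 2 * (S (m.+1 ^ 2) t - c * q) ^+ 2).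
    by apply: eq_Rintegral => t _; rewrite /f -/c; field; rewrite gt_eqF.
  rewrite RintegralZl//; last first.
    exact: bounded_measurable_integrable (bS _).
  rewrite variance_S -/c.
  have -> : m.+1%:R ^- 2 = c^-1 :> R by rewrite /c natrX.
  have -> : c ^- 2 * (c * (q * (1 - q))) = c^-1 * (q * (1 - q)).
    by field; rewrite gt_eqF.
  by rewrite ler_piMr// invr_ge0 ltW.
have : {ae P, forall t, f m t @[m --> \oo] --> (0 : R)}.
  apply: (@summable_integrals_cvg0 f 2) => // [m t|n]; first exact: sqr_ge0.
  apply: (@le_trans _ _ (\sum_(m < n) (m.+1%:R ^- 2 : R)%:E)%E).
    by apply: lee_sum => m _; exact: fint.
  by rewrite sumEFin lee_fin sum_inv_sqr_le.
apply: filterS => t ft.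
apply/cvgrPdist_le => /= e e0.
have e2 : 0 < e / 2 by rewrite divr_gt0.
have [M _ fM] : \forall m \near \oo, f m t <= (e / 2) ^+ 2.
  have e22 : 0 < (e / 2) ^+ 2 by rewrite exprn_gt0.
  have /cvgrPdist_le/(_ _ e22) := ft; apply: filterS => m.
  by rewrite sub0r normrN ger0_norm// sqr_ge0.
near=> n.
have [m /andP[mn nm]] := sqrt_interval n.
(* Once n >= K^2, the integer root m is at least K; then the bound along squares applies and 4/m <=
   e/2. *)
pose K := (maxn M (Num.truncn (8 / e))).+1.
have mK : (K <= m)%N.
  rewrite -ltnS -ltn_sqr; apply: leq_ltn_trans nm.
  by near: n; exact: nbhs_infty_ge.
have mM : (M < m)%N by apply: leq_trans mK; rewrite ltnS leq_maxl.
have m0 : (0 < m)%N by exact: leq_ltn_trans mM.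
have m0R : 0 < m%:R :> R by rewrite ltr0n.
have me : 4 / m%:R <= e / 2.
  have : 8 / e <= m%:R.
    apply: le_trans (ltW (truncnS_gt _)) _; rewrite ler_nat.
    by apply: leq_trans mK; rewrite ltnS leq_maxr.
  rewrite !ler_pdivrMr//; lra.
have n0R : 0 < n%:R :> R.
  by rewrite ltr0n (leq_trans _ mn)// expn_gt0 m0.
have h1 : `|S (m ^ 2) t / (m ^ 2)%:R - q| <= e / 2.
  have := fM m.-1; rewrite /= -ltnS prednK// => /(_ mM).
  rewrite /f prednK// => h.
  rewrite -(@ler_pXn2r _ 2) ?nnegrE ?normr_ge0 ?(ltW e2)//.
  by rewrite real_normK ?num_real.
have h2 : `|S n t / n%:R - S (m ^ 2) t / (m ^ 2)%:R| <= e / 2.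
  apply: (le_trans _ me).
  have mR0 : 0 < (m ^ 2)%:R :> R by rewrite ltr0n expn_gt0 m0.
  have mnR : (m ^ 2)%:R <= n%:R :> R by rewrite ler_nat.
  have nmR : n%:R - (m ^ 2)%:R <= 2 * m%:R :> R.
    have : n%:R + 1 <= (m.+1 ^ 2)%:R :> R by rewrite natr1 ler_nat.
    by rewrite !natrX -natr1; lra.
  have /andP[D0 D1] := S_diff t mn.
  have r0 : 0 <= S (m ^ 2) t / (m ^ 2)%:R by rewrite divr_ge0.
  have r1 : S (m ^ 2) t / (m ^ 2)%:R <= 1 by rewrite ler_pdivrMr// mul1r.
  have step : (n%:R - (m ^ 2)%:R) / n%:R <= 2 / m%:R :> R.
    apply: (@le_trans _ _ (2 * m%:R / (m ^ 2)%:R)); last first.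
      rewrite natrX le_eqVlt; apply/orP; left; apply/eqP.
      by field; rewrite gt_eqF.
    apply: ler_pM => //; first by rewrite subr_ge0.
    by rewrite lef_pV2.
  have step0 : 0 <= (n%:R - (m ^ 2)%:R) / n%:R :> R.
    by rewrite divr_ge0// subr_ge0.
  (* The change of the count and the change of the denominator each contribute at most (n - m^2)/n
     <= 2/m. *)
  have -> : S n t / n%:R - S (m ^ 2) t / (m ^ 2)%:R =
      (S n t - S (m ^ 2) t) / n%:R -
      (S (m ^ 2) t / (m ^ 2)%:R) * ((n%:R - (m ^ 2)%:R) / n%:R).
    by field; rewrite !gt_eqF.
  apply: le_trans (ler_normB _ _) _.
  rewrite ger0_norm; last by rewrite divr_ge0.
  rewrite ger0_norm; last exact: mulr_ge0.
  have -> : 4 / m%:R = 2 / m%:R + 2 / m%:R :> R by field; rewrite gt_eqF.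
  apply: lerD; apply: le_trans step; last by rewrite ler_piMl.
  by rewrite ler_pM2r ?invr_gt0.
rewrite distrC -/(S n t).
have -> : S n t / n%:R - q = (S n t / n%:R - S (m ^ 2) t / (m ^ 2)%:R) +
   (S (m ^ 2) t / (m ^ 2)%:R - q) by ring.
by apply: le_trans (ler_normD _ _) _; lra.
Unshelve. all: by end_near.
Qed.

End strong_law.

(** * The Poisson-binomial model *)

Section conditioning.
Context {d : measure_display} {T : measurableType d} {R : realType}.
Variable P : probability T R.
Implicit Types (A B : set T) (u v h g : T -> R).

(* [h] is within [1/N] of the step function taking the value [k/N] on
   [h @^-1` [k/N, (k+1)/N[]. *)
Lemma eq_Rintegral_mul A u v h : measurable A ->
  measurable_fun setT h ->
  bounded_measurable A u -> bounded_measurable A v ->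
  (forall t, A t -> `|u t| <= 1) -> (forall t, A t -> `|v t| <= 1) ->
  (forall t, A t -> 0 <= h t <= 1) ->
  (forall a b : R,
    \int[P]_(t in A) (\1_(h @^-1` `[a, b[%classic) t * u t) =
    \int[P]_(t in A) (\1_(h @^-1` `[a, b[%classic) t * v t)) ->
  \int[P]_(t in A) (h t * u t) = \int[P]_(t in A) (h t * v t).
Proof.
move=> mA mh bu bv u1 v1 h01 hB.
have bi B : measurable B -> bounded_measurable A (\1_B : T -> R).
  move=> mB; split; first exact: measurable_indic.
  by exists 1 => t _; rewrite indicE ger0_norm// lern1 leq_b1.
have bh : bounded_measurable A h.
  split; first exact: measurable_funTS.
  by exists 1 => t /h01 /andP[h0 h1]; rewrite ger0_norm.
apply/eqP; rewrite -subr_eq0 -normr_le0; apply/ler_addgt0Pr => e e0.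
rewrite add0r.
pose N := (Num.truncn (2 / e)).+1.
have N0 : 0 < N%:R :> R by rewrite ltr0n.
pose B (k : nat) : set T := h @^-1` `[k%:R / N%:R, k.+1%:R / N%:R[%classic.
(* There are N + 1 levels because the value h = 1 falls into the level k = N. *)
pose hN t : R := \sum_(k < N.+1) (k%:R / N%:R) * \1_(B k) t.
have mB k : measurable (B k).
  by rewrite -[B k]setTI; apply: mh => //; exact: measurable_itv.
have near t : A t -> `|h t - hN t| <= 1 / N%:R.
  move=> At; have /andP[h0 h1] := h01 t At.
  pose k := Num.truncn (h t * N%:R).
  have hN0 : 0 <= h t * N%:R by rewrite mulr_ge0// ltW.
  have /andP[k1 k2] := truncn_itv hN0.
  have kN : (k < N.+1)%N.
    rewrite ltnS -(ler_nat R) (le_trans k1)//.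
    by rewrite ler_piMl// ltW.
  have Bt (j : nat) : \1_(B j) t = (j == k)%:R :> R.
    rewrite indicE; congr (_%:R); congr nat_of_bool.
    apply/idP/eqP => [|->].
      rewrite inE /B/= in_itv/= ler_pdivrMr// ltr_pdivlMr// => /andP[j1 j2].
      apply/eqP; rewrite eqn_leq; apply/andP; split; rewrite -ltnS -(ltr_nat R).
        exact: le_lt_trans j1 k2.
      exact: le_lt_trans k1 j2.
    by rewrite inE /B/= in_itv/= ler_pdivrMr// ltr_pdivlMr// k1 k2.
  have -> : hN t = k%:R / N%:R.
    rewrite /hN (bigD1 (Ordinal kN))//= Bt eqxx mulr1 big1 ?addr0// => j jk.
    rewrite Bt; move: jk; rewrite -val_eqE/= => /negbTE ->.
    by rewrite mulr0.
  have -> : h t - k%:R / N%:R = (h t * N%:R - k%:R) / N%:R.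
    by field; rewrite gt_eqF.
  rewrite ger0_norm ?divr_ge0 ?subr_ge0//.
  by rewrite ler_pM2r ?invr_gt0// lerBlDr addrC natr1 ltW.
have bhN : bounded_measurable A hN.
  have [] := Rintegral_sum mA P (index_enum 'I_N.+1) (fun k : 'I_N.+1 =>
    bounded_measurableZ (k%:R / N%:R) (bi _ (mB k))).
  by [].
have int_hN w : bounded_measurable A w ->
    \int[P]_(t in A) (hN t * w t) =
    \sum_(k < N.+1) (k%:R / N%:R) * \int[P]_(t in A) (\1_(B k) t * w t).
  move=> bw.
  have bkw (k : 'I_N.+1) := bounded_measurableM (bi _ (mB k)) bw.
  have [_ e1] := Rintegral_sum mA P (index_enum 'I_N.+1) (fun k : 'I_N.+1 =>
    bounded_measurableZ (k%:R / N%:R) (bkw k)).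
  transitivity (\int[P]_(x in A)
    \sum_(k < N.+1) k%:R / N%:R * (\1_(B k) x * w x)).
    apply: eq_Rintegral => t _; rewrite /hN mulr_suml.
    by apply: eq_bigr => k _; rewrite mulrA.
  rewrite e1; apply: eq_bigr => k _.
  rewrite RintegralZl//.
  exact: bounded_measurable_integrable (bkw k).
have dist w : bounded_measurable A w -> (forall t, A t -> `|w t| <= 1) ->
    `|\int[P]_(t in A) (h t * w t) - \int[P]_(t in A) (hN t * w t)| <= 1 / N%:R.
  move=> bw w1; apply: Rintegral_dist_le => //.
  - exact: bounded_measurableM.
  - exact: bounded_measurableM.
  move=> t At; rewrite -mulrBl normrM -[leRHS]mulr1.
  by apply: ler_pM => //; [exact: near|exact: w1].
have eqN : \int[P]_(t in A) (hN t * u t) = \int[P]_(t in A) (hN t * v t).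
  rewrite !int_hN//; apply: eq_bigr => k _; congr (_ * _).
  exact: hB.
have := dist u bu u1; have := dist v bv v1; rewrite eqN.
set a := \int[P]_(t in A) (h t * u t); set b := \int[P]_(t in A) (h t * v t).
set c := \int[P]_(t in A) (hN t * v t) => bc ac.
have -> : a - b = (a - c) - (b - c) by ring.
apply: (le_trans (ler_normB _ _)); apply: (le_trans (lerD ac bc)).
have : 2 / e <= N%:R by rewrite ltW// truncnS_gt.
rewrite ler_pdivrMr// => Ne.
by rewrite -mulrDl ler_pdivrMr// mulrC; lra.
Qed.

Lemma Rintegral_indicM A B f : \int[P]_(t in A) (\1_B t * f t) =
  \int[P]_(t in A `&` B) f t.
Proof.
rewrite Rintegral_mkcondr; apply: eq_Rintegral => t _.
rewrite patchE indicE; case: (t \in B); by rewrite ?mul1r ?mul0r.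
Qed.

Lemma Rintegral_cst1 A : measurable A -> \int[P]_(t in A) 1 = fine (P A).
Proof. by move=> mA; rewrite Rintegral_cst// mul1r. Qed.

Lemma is_cond_prob_Rintegral (F : set (set T)) E g A :
  is_cond_prob P F E g -> F A ->
  \int[P]_(t in A) g t = fine (P (A `&` E)).
Proof. by move=> [_ _ gE] FA; rewrite /Rintegral gE. Qed.

Lemma sigma_sub_measurable (G : set (set T)) : G `<=` measurable ->
  <<s G >> `<=` measurable.
Proof.
by move=> GT; apply: smallest_sub => //; exact: sigma_algebra_measurable.
Qed.

Lemma sigma_algebraI (G : set (set T)) A B :
  <<s G >> A -> <<s G >> B -> <<s G >> (A `&` B).
Proof. exact: (@measurableI _ (g_sigma_algebraType G)). Qed.

(** Pulling a known factor out of a conditional probability. [eq_Rintegral_mul] reduces it to level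
    sets of [h], whose intersections with [A] stay in the sigma-algebra. *)
Lemma is_cond_prob_mul (G : set (set T)) E g h A :
  <<s G >> `<=` measurable -> measurable E -> is_cond_prob P <<s G >> E g ->
  <<s G >> A -> (forall t, A t -> 0 <= g t <= 1) ->
  (forall t, A t -> 0 <= h t <= 1) ->
  (forall B : set R, measurable B -> <<s G >> (h @^-1` B)) ->
  \int[P]_(t in A) (h t * g t) = \int[P]_(t in A `&` E) h t.
Proof.
move=> sG mE gE GA g01 h01 Gh; have mA := sG _ GA.
have [mg _ _] := gE.
have mg' : measurable_fun A g.
  by apply: measurable_funTS => _ B mB; rewrite setTI; apply: sG; exact: mg.
have mh : measurable_fun setT h.
  by move=> _ B mB; rewrite setTI; apply: sG; exact: Gh.
rewrite -Rintegral_indicM.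
rewrite (@eq_Rintegral_mul A g (\1_E) h)//.
- by apply: eq_Rintegral => t _; rewrite mulrC.
- by split => //; exists 1 => t /g01 /andP[g0 g1]; rewrite ger0_norm.
- split; first exact: measurable_indic.
  by exists 1 => t _; rewrite indicE ger0_norm// lern1 leq_b1.
- by move=> t /g01 /andP[g0 g1]; rewrite ger0_norm.
- by move=> t _; rewrite indicE ger0_norm// lern1 leq_b1.
move=> a b; have GB : <<s G >> (h @^-1` `[a, b[%classic).
  by apply: Gh; exact: measurable_itv.
have GAB := sigma_algebraI GA GB.
rewrite !Rintegral_indicM (is_cond_prob_Rintegral gE GAB).
transitivity (\int[P]_(t in (A `&` h @^-1` `[a, b[%classic)) (\1_E t * 1)).
  rewrite Rintegral_indicM Rintegral_cst1//.
  by apply: measurableI => //; exact: sG.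
by apply: eq_Rintegral => t _; rewrite mulr1.
Qed.

End conditioning.

Section model.
Context {d : measure_display} {Omega : measurableType d} {R : realType}.
Variables (P : probability Omega R) (G : probability (R * R)%type R).
Variables (lambda p : nat -> {RV P >-> R}) (K X : nat -> {RV P >-> nat}).
Hypothesis model : poisson_binomial_model lambda p K X G.
Implicit Types v : nat * nat.

Let F := params_sigma lambda p.
Let par := params lambda p.

Definition param_space : set (R * R) := [set x | 0 <= x.1 /\ 0 <= x.2 <= 1].
Let S := param_space.

Let mS : measurable S.
Proof.
have -> : S = `[0, +oo[ `*` `[0, 1]; last exact: measurableX.
by apply/seteqP; split => -[a b] /=; rewrite !in_itv/= andbT.
Qed.

Let mpar i : measurable_fun setT (par i).
Proof. by apply: measurable_fun_pair; exact: measurable_funPT. Qed.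

Let mF : F `<=` measurable.
Proof.
apply: sigma_sub_measurable => _ [i _ [B mB <-]].
by apply: mpar.
Qed.

Let F_par i (B : set (R * R)) : measurable B -> F (par i @^-1` B).
Proof.
move=> mB; apply: sub_sigma_algebra; exists i => //.
by exists B => //; rewrite setTI.
Qed.

Let plaw i B : measurable B -> P (par i @^-1` B) = G B.
Proof. by case: model => _ + _ _ _ _; apply. Qed.

(** The parameters lie in their range only almost surely; pointwise bounds are used on this event of
    full measure. *)
Let good i : set Omega := par i @^-1` S.

Let mgood i : measurable (good i).
Proof. by apply: mF; exact: F_par. Qed.

Let P_good i : P (good i) = 1%E.
Proof. by rewrite /good plaw//; exact: mixing_support model. Qed.

Let P_goodC i : P (~` good i) = 0%E.
Proof. by rewrite probability_setC// P_good subee. Qed.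

Let P_goodI i A : measurable A -> P (A `&` good i) = P A.
Proof.
move=> mA.
rewrite [in RHS](measureDI P mA (mgood i)) [X in (X + _)%E](_ : _ = 0%E) ?add0e//.
apply: (@subset_measure0 _ _ _ P _ (~` good i)).
- exact: measurableD.
- exact: measurableC.
- by move=> w [].
- exact: P_goodC.
Qed.

Let success v (x : R * R) : R := x.2 ^+ v.1 * (1 - x.2) ^+ v.2.

(** The conditional probability of v.1 successes and v.2 failures given the parameters; the
    indicator keeps it in [0, 1] on the whole plane. *)
Definition count_pmf v (x : R * R) : R := \1_S x *
  (poisson_mass x.1 (v.1 + v.2) * ('C(v.1 + v.2, v.1)%:R * success v x)).

(** Almost surely the event that [W i] equals v. Stated through [K] and [X], it is unaffected by the
    truncated subtraction. *)
Definition count_event v i : set Omega :=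
  counts K X i @^-1` [set ((v.1 + v.2)%N, v.1)].

Let count_eventE v i : count_event v i =
  (K i @^-1` [set (v.1 + v.2)%N]) `&` (X i @^-1` [set v.1]).
Proof.
by apply/seteqP; split => w; rewrite /count_event /counts/=; [case|move=> [-> ->]].
Qed.

Let mK i k : measurable (K i @^-1` [set k]).
Proof. by rewrite -[_ @^-1` _]setTI; apply: measurable_funPT. Qed.

Let mX i k : measurable (X i @^-1` [set k]).
Proof. by rewrite -[_ @^-1` _]setTI; apply: measurable_funPT. Qed.

Let mcount v i : measurable (count_event v i).
Proof. by rewrite count_eventE; exact: measurableI. Qed.

Let msuccess v : measurable_fun setT (success v).
Proof.
apply: measurable_funM; apply: measurable_funX => //.
exact: measurable_funB.
Qed.

Let success01 v x : S x -> 0 <= success v x <= 1.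
Proof.
move=> [_ /andP[x0 x1]]; have x1' : 0 <= 1 - x.2 by rewrite subr_ge0.
rewrite mulr_ge0 ?exprn_ge0//= mulr_ile1 ?exprn_ge0 ?exprn_ile1//.
by rewrite gerBl.
Qed.

Let mcount_pmf v : measurable_fun setT (count_pmf v).
Proof.
apply: measurable_funM; first exact: measurable_indic.
apply: measurable_funM; last exact: measurable_funM.
exact: (measurableT_comp (measurable_poisson_mass _)).
Qed.

(** The left-hand side is one term of the binomial expansion of (x.2 + (1 - x.2))^(v.1 + v.2). *)
Let binomial_success_le1 v x : S x ->
  'C(v.1 + v.2, v.1)%:R * success v x <= 1.
Proof.
move=> [_ /andP[x0 x1]]; have x1' : 0 <= 1 - x.2 by rewrite subr_ge0.
rewrite -[leRHS](expr1n _ (v.1 + v.2)) -[X in X ^+ _](subrK x.2 1) addrC exprDn.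
rewrite (bigD1 (inord v.2))//= inordK ?ltnS ?leq_addl// addnK.
rewrite -bin_sub ?leq_addr// addKn mulr_natl lerDl sumr_ge0// => i _.
by rewrite mulrn_wge0// mulr_ge0 ?exprn_ge0.
Qed.

Let count_pmf01 v x : 0 <= count_pmf v x <= 1.
Proof.
rewrite /count_pmf indicE; have [|] := boolP (x \in S); last first.
  by rewrite mul0r lexx ler01.
rewrite inE mul1r => Sx; have /andP[s0 _] := success01 v Sx.
have [x0 _] := Sx.
have c0 : 0 <= 'C(v.1 + v.2, v.1)%:R * success v x := mulr_ge0 (ler0n _ _) s0.
have p0 := poisson_mass_ge0 (v.1 + v.2) x0.
rewrite mulr_ge0//=; apply: mulr_ile1 => //; first exact: poisson_mass_le1.
exact: binomial_success_le1.
Qed.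

Let count_pmf_bounded v : exists M : R, forall x, `|count_pmf v x| <= M.
Proof.
by exists 1 => x; have /andP[f0 f1] := count_pmf01 v x; rewrite ger0_norm.
Qed.

Let count_pmf_par_bm v i A : measurable A ->
  bounded_measurable A (fun w => count_pmf v (par i w)).
Proof.
move=> mA; split; first by apply: measurable_funTS; exact: measurableT_comp.
by have [M vM] := count_pmf_bounded v; exists M => w _; exact: vM.
Qed.

(** The tower property. On K = k the binomial mass of [X] depends on the parameters alone, so it can
    be pulled out against the conditional law of [K]. *)
Lemma count_event_cond_prob v i :
  is_cond_prob P F (count_event v i) (fun w => count_pmf v (par i w)).
Proof.
split.
- move=> B mB; rewrite (_ : _ @^-1` _ = par i @^-1` (count_pmf v @^-1` B))//.
  by apply: F_par; rewrite -[X in measurable X]setTI; exact: mcount_pmf.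
- exact/bounded_measurable_integrable/count_pmf_par_bm.
move=> A FA; have mA := mF FA.
suff : \int[P]_(w in A) count_pmf v (par i w) = fine (P (A `&` count_event v i)).
  have iA : P.-integrable A (EFin \o (fun w => count_pmf v (par i w))).
    exact/bounded_measurable_integrable/count_pmf_par_bm.
  move=> e; rewrite -[RHS]fineK; last first.
    by apply: fin_num_measure; exact: measurableI.
  by rewrite -e /Rintegral fineK//; exact: integrable_fin_num.
pose k := (v.1 + v.2)%N; pose c : R := 'C(k, v.1)%:R.
(* On [good i] both factors lie in [0, 1]. Restricting to it changes neither side: its complement is
   null and [count_pmf] vanishes there. *)
pose A' := A `&` good i.
have FA' : F A' by apply: sigma_algebraI => //; exact: F_par.
have mA' := mF FA'.
have kK := K_cond_law model i k.
have kX := X_cond_law model i v.1.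
have bs B : B `<=` good i -> measurable B ->
    bounded_measurable B (fun w => success v (par i w)).
  move=> Bg mB; split; first by apply: measurable_funTS; exact: measurableT_comp.
  by exists 1 => w /Bg /(success01 v) /andP[s0 s1]; rewrite ger0_norm.
have bp : bounded_measurable A' (fun w => poisson_mass (par i w).1 k).
  split.
    apply: measurable_funTS; apply: (measurableT_comp (measurable_poisson_mass _)).
    exact: (measurableT_comp measurable_fst).
  exists 1 => w [_ [w0 _]].
  by rewrite ger0_norm ?poisson_mass_ge0 ?poisson_mass_le1.
transitivity (c * \int[P]_(w in A')
    (success v (par i w) * poisson_mass (par i w).1 k)).
  rewrite -RintegralZl//; last first.
    apply: bounded_measurable_integrable => //; apply: bounded_measurableM => //.
    by apply: bs => // w [].
  rewrite -Rintegral_indicM; apply: eq_Rintegral => w _.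
  by rewrite /count_pmf -/k -/c /good/= [\1__ w]indicE /=; ring.
rewrite (is_cond_prob_mul mF (mK i k) kK FA')//; first last.
- move=> B mB; rewrite (_ : _ @^-1` _ = par i @^-1` (success v @^-1` B))//.
  by apply: F_par; rewrite -[X in measurable X]setTI; exact: msuccess.
- by move=> w [_ Sw]; exact: success01.
- move=> w [_ [w0 _]].
  by rewrite poisson_mass_ge0 ?poisson_mass_le1.
have mAK : measurable (A' `&` K i @^-1` [set k]) by exact: measurableI.
rewrite -RintegralZl//; last first.
  by apply: bounded_measurable_integrable => //; apply: bs => // w [[]].
transitivity (\int[P]_(w in A' `&` K i @^-1` [set k])
   binomial_pmf (K i w) (p i w) v.1).
  apply: eq_Rintegral => w; rewrite inE => -[_ /= ->].
  by rewrite /binomial_pmf addKn mulr_natl.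
rewrite (is_cond_prob_Rintegral kX); last first.
  apply: sigma_algebraI.
    by apply: sub_sigma_algebra; left.
  apply: sub_sigma_algebra; right; exists [set k] => //; by rewrite setTI.
congr fine; rewrite -[RHS](@P_goodI i); last exact: measurableI.
congr (P _); rewrite count_eventE -/k /A'.
by apply/seteqP; split => w; rewrite /setI/=; tauto.
Qed.

Lemma count_event_prob v i :
  (P (count_event v i) = (\int[G]_x count_pmf v x)%:E)%E.
Proof.
have [_ _ ce] := count_event_cond_prob v i.
have FT : F setT.
  by rewrite (_ : setT = par 0 @^-1` setT)//; exact: F_par.
have {}ce := ce _ FT; rewrite setTI in ce.
have bG : bounded_measurable setT (count_pmf v).
  by split => //; have [M vM] := count_pmf_bounded v; exists M => x _.
rewrite /Rintegral fineK; last first.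
  by apply: integrable_fin_num => //; exact: bounded_measurable_integrable bG.
transitivity (\int[pushforward P (par i)]_x (count_pmf v x)%:E)%E.
  rewrite integral_pushforward//.
  - exact/measurable_EFinP.
  - rewrite preimage_setT.
    exact: (bounded_measurable_integrable measurableT P
      (count_pmf_par_bm v i measurableT)).
apply: eq_measure_integral => B mB _.
exact: plaw.
Qed.

Let par_indep i j B1 B2 : i != j -> measurable B1 -> measurable B2 ->
  P (par i @^-1` B1 `&` par j @^-1` B2) = (G B1 * G B2)%E.
Proof.
move=> ij mB1 mB2.
have ind : mutually_independent P par by case: model.
have := ind [fset i; j]%fset (fun k => if k == i then B1 else B2) _.
have -> : \bigcap_(k in [set` [fset i; j]%fset])
    (par k @^-1` (if k == i then B1 else B2)) =
    par i @^-1` B1 `&` par j @^-1` B2.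
  apply/seteqP; split => w /=.
    move=> h; have := h i; have := h j.
    rewrite /= !inE !eqxx orbT eq_sym (negbTE ij)/= => h2 h1.
    by split; [exact: h1|exact: h2].
  move=> [h1 h2] k /=; rewrite !inE => /orP[/eqP ->|/eqP ->].
    by rewrite eqxx.
  by rewrite eq_sym (negbTE ij).
move=> ->; last by move=> k; case: ifP.
rewrite big_fsetU1 ?inE//= big_seq_fset1 eqxx eq_sym (negbTE ij).
by congr (_ * _)%E; exact: plaw.
Qed.

(** Conditional independence gives the expectation of f_i f_j, a product of functions of two
    independent parameters. It factors by two uses of [eq_Rintegral_mul], each reducing one function
    to its level sets. *)
Lemma count_event_pair_prob v i j : i != j ->
  P (count_event v i `&` count_event v j) =
  ((\int[G]_x count_pmf v x) ^+ 2)%:E.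
Proof.
move=> ij.
have FT : F setT.
  by rewrite (_ : setT = par 0 @^-1` setT)//; exact: F_par.
pose q := \int[G]_x count_pmf v x.
pose f (k : nat) w := count_pmf v (par k w).
have bf k A : measurable A -> bounded_measurable A (f k).
  exact: count_pmf_par_bm.
have mf k : measurable_fun setT (f k) by exact: (bf k setT measurableT).1.
have f01 k w : 0 <= f k w <= 1 by exact: count_pmf01.
have nf1 k w : `|f k w| <= 1.
  by have /andP[f0 f1] := f01 k w; rewrite ger0_norm.
have Ef k : \int[P]_w f k w = q.
  rewrite (is_cond_prob_Rintegral (count_event_cond_prob v k) FT) setTI.
  by rewrite count_event_prob.
have fpre k (a b : R) : exists2 B, measurable B &
    f k @^-1` `[a, b[%classic = par k @^-1` B.
  exists (count_pmf v @^-1` `[a, b[%classic) => //.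
  by rewrite -[X in measurable X]setTI; apply: mcount_pmf.
have mpre k B : measurable B -> measurable (par k @^-1` B).
  by move=> mB; apply: mF; exact: F_par.
(* Level sets of [f i] are events on the i-th parameters, so independence lets the indicator be
   replaced by the constant G B. *)
have step1 B : measurable B ->
    \int[P]_w (f i w * \1_(par j @^-1` B) w) = fine (G B) * q.
  move=> mB; rewrite
    (@eq_Rintegral_mul _ _ _ P setT _ (cst (fine (G B))) (f i))//.
  - rewrite -[in RHS](Ef i) mulrC -RintegralZr//.
    exact/bounded_measurable_integrable/bf.
  - split; first exact: measurable_indic (mpre _ _ mB).
    by exists 1 => w _; rewrite indicE ger0_norm// lern1 leq_b1.
  - exact: bounded_measurable_cst.
  - by move=> w _; rewrite indicE ger0_norm// lern1 leq_b1.
  - move=> w _ /=; rewrite ger0_norm ?fine_ge0//.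
    by rewrite -lee_fin fineK ?probability_le1//; exact: fin_num_measure.
  move=> a b; have [B1 mB1 ->] := fpre i a b.
  rewrite !(Rintegral_indicM P setT (par i @^-1` B1)) !setTI.
  rewrite [RHS](Rintegral_cst P (mpre i B1 mB1)).
  transitivity (\int[P]_(w in par i @^-1` B1) (\1_(par j @^-1` B) w * 1)).
    by apply: eq_Rintegral => w _; rewrite mulr1.
  rewrite Rintegral_indicM Rintegral_cst1; last first.
    by apply: measurableI; exact: mpre.
  rewrite (congr1 fine (plaw i mB1) : fine (P _) = _).
  rewrite (par_indep ij mB1 mB) mulrC.
  by rewrite fineM//; exact: fin_num_measure.
have q01 : 0 <= q <= 1.
  by rewrite -!lee_fin -(count_event_prob v i) measure_ge0 probability_le1.
(* Now [f j] is reduced to its level sets, on which [step1] replaces [f i] by the constant q. *)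
have step2 : \int[P]_w (f j w * f i w) = q ^+ 2.
  have /andP[q0 q1] := q01.
  rewrite (@eq_Rintegral_mul _ _ _ P setT _ (cst q) (f j))//.
  - rewrite expr2 -[X in _ = X * _](Ef j) -RintegralZr//.
    exact/bounded_measurable_integrable/bf.
  - exact: bf.
  - exact: bounded_measurable_cst.
  - by move=> w _ /=; rewrite ger0_norm.
  move=> a b; have [B mB ->] := fpre j a b.
  transitivity (\int[P]_w (f i w * \1_(par j @^-1` B) w)).
    by apply: eq_Rintegral => w _; rewrite mulrC.
  rewrite step1// (Rintegral_indicM P setT (par j @^-1` B)) setTI.
  rewrite [RHS](Rintegral_cst P (mpre j B mB)).
  by rewrite (congr1 fine (plaw j mB) : fine (P _) = _) mulrC.
have cind : cond_independent P F (counts K X).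
  by case: model.
have cp := cind [fset i; j]%fset (fun=> [set ((v.1 + v.2)%N, v.1)]) f.
have {}cp := cp _ (fun k _ => count_event_cond_prob v k).
have eI : \bigcap_(k in [set` [fset i; j]%fset])
    counts K X k @^-1` [set ((v.1 + v.2)%N, v.1)] =
    count_event v i `&` count_event v j.
  apply/seteqP; split => w /=.
    by move=> h; split; apply: h; rewrite /= !inE eqxx ?orbT.
  by move=> [h1 h2] k /=; rewrite !inE => /orP[/eqP ->|/eqP ->].
rewrite eI in cp.
have := is_cond_prob_Rintegral (cp _) FT; rewrite setTI => e.
rewrite -[LHS]fineK ?fin_num_measure//; last exact: measurableI.
congr EFin; rewrite -/q -step2 -e; last first.
  move=> _; rewrite (_ : [set _] = [set (v.1 + v.2)%N] `*` [set v.1]).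
    exact: measurableX.
  by apply/seteqP; split => -[k l] /=; [case=> -> ->|case=> <- <-].
apply: eq_Rintegral => w _.
by rewrite big_fsetU1 ?inE//= big_seq_fset1 mulrC.
Qed.

(** The binomial mass vanishes above its size, so each of the countably many events K i = k, X i = x
    with k < x is null. *)
Let X_le_K : {ae P, forall w i, (X i w <= K i w)%N}.
Proof.
have null i k x : (k < x)%N -> {ae P, forall w, ~ (K i w = k /\ X i w = x)}.
  move=> kx; exists ((K i @^-1` [set k]) `&` (X i @^-1` [set x])); split.
  - exact: measurableI.
  - have kX := X_cond_law model i x.
    rewrite -[LHS]fineK ?fin_num_measure//; last exact: measurableI.
    rewrite -(is_cond_prob_Rintegral kX); last first.
      apply: sub_sigma_algebra; right; exists [set k] => //.
      by rewrite setTI.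
    congr EFin; transitivity (\int[P]_(w in K i @^-1` [set k]) (0 : R)).
      apply: eq_Rintegral => w; rewrite inE => /= ->.
      by rewrite /binomial_pmf bin_small// mulr0n.
    by rewrite Rintegral_cst ?mul0r.
  - by move=> w /= /contrapT.
have all_null : {ae P, forall w i k x, (k < x)%N -> ~ (K i w = k /\ X i w = x)}.
  apply: ae_foralln => i; apply: ae_foralln => k; apply: ae_foralln => x.
  have [kx|xk] := ltnP k x; first by apply: filterS (null i k x kx).
  by apply: aeW => w.
apply: filterS all_null => w nw i; rewrite leqNgt; apply/negP => KX.
by apply: (nw i _ _ KX); split.
Qed.

(** There are countably many values v, so one null set serves for all the strong laws; off the null
    set of [X_le_K], W i = v is the event [count_event v i]. *)
Lemma observation_frequency_cvg : {ae P, forall w v,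
  frequency n (fun i => W K X i w) v @[n --> \oo] --> \int[G]_x count_pmf v x}.
Proof.
have law : {ae P, forall w a b,
    (\sum_(k < n) \1_(count_event (a, b) k) w) / n%:R @[n --> \oo] -->
    \int[G]_x count_pmf (a, b) x}.
  apply: ae_foralln => a; apply: ae_foralln => b; apply: strong_law_indic.
  - by move=> i; exact: mcount.
  - by move=> i; exact: count_event_prob.
  - by move=> i j; exact: count_event_pair_prob.
apply: filterS2 law X_le_K => w law XK [a b].
rewrite (_ : (fun n => _) =
  (fun n => (\sum_(k < n) \1_(count_event (a, b) k) w) / n%:R))//.
apply/funext => n; rewrite /frequency; congr (_ / _); apply: eq_bigr => k _.
rewrite indicE; congr (_%:R); congr nat_of_bool.
rewrite /W /count_event /counts /preimage/=; apply/eqP/idP.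
  by move=> [Xa KX]; rewrite inE/= -KX -{1}Xa subnKC// Xa.
by rewrite inE/= => -[-> ->]; rewrite addKn.
Qed.

(** * Splitting a Poisson variable *)

Section xi_law.
Variable Gxi : probability (R * R)%type R.
Hypothesis Gxi_law : forall (i : nat) (A : set (R * R)), measurable A ->
  P (xi lambda p i @^-1` A) = Gxi A.

Let Q := @quadrant R.
Let mQ : measurable Q := measurable_quadrant.

Let mxi i : measurable_fun setT (xi lambda p i).
Proof.
apply: measurable_fun_pair; apply: measurable_funM => //.
exact: measurable_funB.
Qed.

Let good_xi i : good i `<=` xi lambda p i @^-1` Q.
Proof.
move=> w [w0 /andP[p0 p1]]; split; rewrite /= mulr_ge0//.
by rewrite subr_ge0.
Qed.

Lemma xi_law_on_quadrant : on_quadrant Gxi.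
Proof.
rewrite /on_quadrant -(Gxi_law 0)//; apply/eqP; rewrite eq_le.
have mxQ : measurable (xi lambda p 0 @^-1` Q).
  by rewrite -[X in measurable X]setTI; exact: mxi.
rewrite probability_le1//= -(P_good 0) le_measure// inE//.
Qed.

(** Poisson splitting: the exponentials of the two rates multiply to e^{-lambda}, and the binomial
    coefficient converts (v.1 + v.2)! into v.1! v.2!. *)
Lemma poisson2_xi v i w : good i w ->
  poisson2 v (xi lambda p i w) = count_pmf v (par i w).
Proof.
move=> gw; rewrite /count_pmf indicE mem_set// mul1r.
rewrite /poisson2 /poisson_mass /success /xi /par /params/=.
set l := lambda i w; set t := p i w.
have -> : expR (- l) = expR (- (t * l)) * expR (- ((1 - t) * l)).
  by rewrite -expRD; congr expR; ring.
have f0 k : k`!%:R != 0 :> R by rewrite pnatr_eq0 -lt0n fact_gt0.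
have -> : (v.1 + v.2)`!%:R =
    'C(v.1 + v.2, v.1)%:R * (v.1`!%:R * v.2`!%:R) :> R.
  by rewrite -!natrM -(bin_fact (leq_addr v.2 v.1)) addKn.
have c0 : 'C(v.1 + v.2, v.1)%:R != 0 :> R.
  by rewrite pnatr_eq0 -lt0n bin_gt0 leq_addr.
by rewrite !exprMn exprD; field; rewrite !f0 c0.
Qed.

(** Both sides are pulled back to [Omega] along index 0 and compared on [good 0], whose complement
    is null. *)
Lemma mixture_xi v : mixture Gxi v = \int[G]_x count_pmf v x.
Proof.
have mxQ : measurable (xi lambda p 0 @^-1` Q).
  by rewrite -[X in measurable X]setTI; exact: mxi.
have ix : P.-integrable (xi lambda p 0 @^-1` Q)
    ((fun y => (poisson2 v y)%:E) \o xi lambda p 0).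
  apply: (bounded_measurable_integrable mxQ P (f := poisson2 v \o xi lambda p 0)).
  split.
    apply: measurable_funTS; apply: measurableT_comp => //.
    exact: measurable_poisson2.
  exists 1 => w Qw /=; rewrite ger0_norm.
    exact: poisson2_le1.
  exact: poisson2_ge0.
apply: EFin_inj; rewrite mixtureE -(count_event_prob v 0).
have FT : F setT.
  by rewrite (_ : setT = par 0 @^-1` setT)//; exact: F_par.
have [_ iT ce] := count_event_cond_prob v 0.
have {}ce := ce _ FT; rewrite setTI in ce; rewrite -ce.
transitivity (\int[pushforward P (xi lambda p 0)]_(x in Q) (poisson2 v x)%:E)%E.
  by apply: eq_measure_integral => B mB _; exact: esym (Gxi_law 0 mB).
rewrite integral_pushforward//; last first.
  by apply/measurable_EFinP; exact: measurable_poisson2.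
have mgC : measurable (~` good 0) by exact: measurableC.
rewrite (negligible_integral mgC mxQ ix (P_goodC 0)).
rewrite [RHS](negligible_integral mgC measurableT iT (P_goodC 0)).
rewrite !setDE !setCK setTI (_ : _ `&` good 0 = good 0); last first.
  by apply/setIidPr; exact: good_xi.
by apply: eq_integral => w; rewrite inE => gw; rewrite /= poisson2_xi.
Qed.

End xi_law.

End model.

Theorem theorem1 (R : realType) (d : measure_display) (Omega : measurableType d)
    (P : probability Omega R)
    (G : probability (R * R)%type R)
    (lambda p : nat -> {RV P >-> R}) (K X : nat -> {RV P >-> nat})
    (model : poisson_binomial_model lambda p K X G)
    (Gxi : probability (R * R)%type R)
    (Gxi_law : forall (i : nat) (A : set (R * R)), measurable A ->
       P (xi lambda p i @^-1` A) = Gxi A)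
    (Ghat : nat -> Omega -> probability (R * R)%type R)
    (Ghat_GMLE : forall (n : nat) (omega : Omega), (0 < n)%N ->
       is_GMLE n (fun i => W K X i omega) (Ghat n omega)) :
  identifiable Gxi /\
  {ae P, forall omega, weakly_converges (fun n => Ghat n omega) Gxi}.
Proof.
have GxiQ : on_quadrant Gxi := xi_law_on_quadrant model Gxi_law.
split; first exact: on_quadrant_identifiable.
(* From here on omega is fixed and the argument is deterministic. *)
apply: filterS (observation_frequency_cvg model) => omega freq.
apply: mixture_cvg_weakly => // v.
apply: (@GMLE_mixture_cvg _ _ (fun i => W K X i omega)) => // [n|u].
  exact: Ghat_GMLE.
by rewrite (mixture_xi model Gxi_law); exact: freq.
Qed.
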